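(* Suppose $d\ge2$. Let $\Lambda\in\mathbb{R}$ and let $\mathcal{F}:\mathcal{P}_2(\mathbb{R}^d)\to\mathbb{R}$ be a continuous $\Lambda$-geodesically convex function. Let $\mu\in\mathcal{P}_2(\mathbb{R}^d)$. Then: (1) for every $h\in[0,1]$ the function $\mathcal{P}_2(\mathbb{R}^d)\ni\nu\mapsto\mathcal{F}((1-h)\mu+h\nu)$ is $h\Lambda$-geodesically convex; (2) if in addition $\mathcal{F}$ is flat differentiable at $\mu$, then for all $y_0,y_1\in\mathbb{R}^d$ and $t,h\in[0,1]$, with $y_t:=(1-t)y_0+ty_1$, $$\mathcal{F}((1-h)\mu+h\delta_{y_t})\le(1-t)\mathcal{F}((1-h)\mu+h\delta_{y_0})+t\mathcal{F}((1-h)\mu+h\delta_{y_1})-h\Lambda\frac{t(1-t)}{2}|y_0-y_1|^2,$$ and the map $\mathbb{R}^d\ni x\mapsto\mathcal{D}_\mu\mathcal{F}(\mu,x)$ is $\Lambda$-convex.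
   Context: $\mathcal{P}_2(\mathbb{R}^d)$ is the space of Borel probability measures on $\mathbb{R}^d$ with finite second moment, with the $L^2$-Wasserstein distance $W_2$; continuity is with respect to $W_2$. $\mathcal{F}$ is $\Lambda$-geodesically convex if for all $\mu_0,\mu_1\in\mathcal{P}_2(\mathbb{R}^d)$ and every constant-speed $W_2$-geodesic $(\mu_t)_{t\in[0,1]}$ from $\mu_0$ to $\mu_1$, $\mathcal{F}(\mu_t)\le(1-t)\mathcal{F}(\mu_0)+t\mathcal{F}(\mu_1)-\frac{\Lambda}{2}t(1-t)W_2^2(\mu_0,\mu_1)$ for all $t\in[0,1]$. $\mathcal{F}$ is flat differentiable at $\mu$ if there is a Borel map $\mathcal{D}_\mu\mathcal{F}(\mu,\cdot):\mathbb{R}^d\to\mathbb{R}$ with at most quadratic growth such that for all $\nu\in\mathcal{P}_2(\mathbb{R}^d)$, $\lim_{h\to0^+}\frac{\mathcal{F}((1-h)\mu+h\nu)-\mathcal{F}(\mu)}{h}=\int\mathcal{D}_\mu\mathcal{F}(\mu,x)(\nu-\mu)(dx)$; it is normalized by $\int\mathcal{D}_\mu\mathcal{F}(\mu,x)d\mu(x)=0$. A function $f:\mathbb{R}^d\to\mathbb{R}$ is $\Lambda$-convex if $f((1-t)y_0+ty_1)\le(1-t)f(y_0)+tf(y_1)-\frac{\Lambda}{2}t(1-t)|y_0-y_1|^2$ for all $y_0,y_1$, $t\in[0,1]$. *)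

(* Defs.v *)
From HB Require Import structures.
From mathcomp Require Import all_boot all_order all_algebra.
From mathcomp Require Import all_classical all_reals all_analysis.
From mathcomp Require Import measurable_realfun.
Set Implicit Arguments.
Unset Strict Implicit.
Unset Printing Implicit Defensive.
Import Order.TTheory GRing.Theory Num.Theory.
Import numFieldNormedType.Exports.
Local Open Scope classical_set_scope.
Local Open Scope ring_scope.

(* The library norm `|x| on 'rV[R]_d is the sup norm, hence this one. *)
Definition enorm (R : realType) (d : nat) (x : 'rV[R]_d) : R :=
  Num.sqrt (\sum_(i < d) x ord0 i ^+ 2).

(* The sup norm and the Euclidean norm have the same open sets, so these are
   the usual Borel sets. *)
Definition Rd (R : realType) (d : nat) := g_sigma_algebraType (@open 'rV[R]_d).

Section P2.
Context (R : realType) (d : nat).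
Local Notation Rd := (Rd R d).

Definition second_moment (mu : probability Rd R) : \bar R :=
  (\int[mu]_x (enorm x ^+ 2)%:E)%E.

(* A library measure is a function on all sets that is constrained on
   measurable sets only, so that two elements of P2 may represent the same Borel
   measure; they are then at W2-distance 0, so that a W2-continuous function on
   P2 takes the same value at both. *)
Record P2 := MkP2 {
  P2_prob :> probability Rd R ;
  P2_finite : (second_moment P2_prob < +oo)%E }.

Definition coupling (mu nu : probability Rd R)
    (gamma : probability (Rd * Rd)%type R) : Prop :=
  forall A : set Rd, measurable A ->
    gamma (A `*` setT) = mu A /\ gamma (setT `*` A) = nu A.

Definition transport_cost (gamma : probability (Rd * Rd)%type R) : \bar R :=
  (\int[gamma]_p (enorm (p.1 - p.2 : 'rV[R]_d) ^+ 2)%:E)%E.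

Definition W2 (mu nu : P2) : R :=
  Num.sqrt (fine (ereal_inf [set transport_cost gamma | gamma in coupling mu nu])).

Definition W2_continuous (F : P2 -> R) : Prop :=
  forall mu (e : R), 0 < e ->
    exists2 r : R, 0 < r & forall nu, W2 mu nu < r -> `|F nu - F mu| < e.

(* Only the restriction of rho to [0, 1] matters. *)
Definition W2_geodesic (mu0 mu1 : P2) (rho : R -> P2) : Prop :=
  [/\ rho 0 = mu0, rho 1 = mu1 &
      forall s t, 0 <= s <= 1 -> 0 <= t <= 1 ->
        W2 (rho s) (rho t) = `|s - t| * W2 mu0 mu1].

Definition geodesically_convex (Lambda : R) (F : P2 -> R) : Prop :=
  forall (mu0 mu1 : P2) (rho : R -> P2), W2_geodesic mu0 mu1 rho ->
  forall t, 0 <= t <= 1 ->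
    F (rho t) <= (1 - t) * F mu0 + t * F mu1
                 - Lambda / 2 * t * (1 - t) * W2 mu0 mu1 ^+ 2.

Lemma measurable_sqr_enorm :
  measurable_fun [set: Rd] (fun x => (enorm x ^+ 2)%:E : \bar R).
Proof.
apply/measurable_EFinP.
have -> : (fun x : Rd => enorm x ^+ 2) =
          (fun x : Rd => \sum_(i < d) (x : 'rV[R]_d) ord0 i ^+ 2).
  by apply/funext => x; rewrite /enorm sqr_sqrtr// sumr_ge0// => i _; exact: sqr_ge0.
apply: measurable_sum => i; apply: measurable_funX.
apply: (measurability _ (RGenOpens.measurableE R)) => _ [_ [a [b ->]] <-].
rewrite setTI; apply: sub_sigma_algebra.
by apply: open_comp => // x _; exact: coord_continuous.
Qed.

Section mixture.
Variables (h : R) (mu nu : P2).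

Definition clamp01 : R := Num.min 1 (Num.max 0 h).

Lemma clamp01_ge0 : 0 <= clamp01.
Proof. by rewrite /clamp01 le_min ler01/= le_max lexx. Qed.

Lemma onem_clamp01_ge0 : 0 <= 1 - clamp01.
Proof. by rewrite subr_ge0 /clamp01 ge_min lexx. Qed.

Definition mix_measure : set Rd -> \bar R :=
  measure_add (mscale (NngNum onem_clamp01_ge0) mu)
              (mscale (NngNum clamp01_ge0) nu).

HB.instance Definition _ := Measure.on mix_measure.

Lemma mix_measure_setT : mix_measure setT = 1%E.
Proof.
rewrite /mix_measure measure_addE /= /mscale /=.
have p1 (p : probability Rd R) : p setT = 1%E := probability_setT p.
by rewrite !p1 !mule1 -EFinD subrK.
Qed.

HB.instance Definition _ :=
  Measure_isProbability.Build _ _ _ mix_measure mix_measure_setT.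

Lemma mix_finite : (second_moment mix_measure < +oo)%E.
Proof.
rewrite /second_moment /mix_measure ge0_integral_measure_add//; last 2 first.
- by move=> x _; rewrite lee_fin sqr_ge0.
- exact: measurable_sqr_enorm.
by rewrite !ge0_integral_mscale//; [|exact: measurable_sqr_enorm|
  by move=> x _; rewrite lee_fin sqr_ge0|exact: measurable_sqr_enorm|
  by move=> x _; rewrite lee_fin sqr_ge0];
  rewrite lte_add_pinfty// lte_mul_pinfty// ?lee_fin ?clamp01_ge0
    ?onem_clamp01_ge0// P2_finite.
Qed.

(* The probability measure (1 - h) mu + h nu; it is meant for 0 <= h <= 1, and
   h is replaced by the closest point of [0, 1] otherwise. *)
Definition mix : P2 := MkP2 mix_finite.

Lemma mixE (A : set Rd) : 0 <= h <= 1 ->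
  mix A = ((1 - h)%:E * mu A + h%:E * nu A)%E.
Proof.
move=> /andP[h0 h1]; rewrite /= /mix_measure measure_addE /= /mscale /=.
by rewrite /clamp01 max_r// min_r.
Qed.

End mixture.

Lemma second_moment_dirac (y : Rd) : (second_moment (\d_y) < +oo)%E.
Proof.
rewrite /second_moment integral_dirac//; last exact: measurable_sqr_enorm.
by rewrite diracT mul1e ltry.
Qed.

Definition diracP2 (y : 'rV[R]_d) : P2 := MkP2 (second_moment_dirac y).

Definition is_flat_derivative (F : P2 -> R) (mu : P2) (D : Rd -> R) : Prop :=
  [/\ measurable_fun setT D,
      exists C : R, forall x, `|D x| <= C * (1 + enorm x ^+ 2),
      forall nu : P2,
        (F (mix h mu nu) - F mu) / h @[h --> 0^'+] -->
          \int[nu]_x D x - \int[mu]_x D x &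
      \int[mu]_x D x = 0].

Definition flat_differentiable (F : P2 -> R) (mu : P2) : Prop :=
  exists D, is_flat_derivative F mu D.

End P2.

Definition lambda_convex (R : realType) (d : nat) (Lambda : R)
    (f : 'rV[R]_d -> R) : Prop :=
  forall (y0 y1 : 'rV[R]_d) (t : R), 0 <= t <= 1 ->
    f ((1 - t) *: y0 + t *: y1) <=
      (1 - t) * f y0 + t * f y1
      - Lambda / 2 * t * (1 - t) * enorm (y0 - y1) ^+ 2.

(* Main.v *)
From HB Require Import structures.
Require Import Defs.
From mathcomp Require Import all_boot all_order all_algebra.
From mathcomp Require Import all_classical all_reals all_analysis.
From mathcomp Require Import measurable_realfun ring lra.
Set Implicit Arguments.
Unset Strict Implicit.
Unset Printing Implicit Defensive.
Import Order.TTheory GRing.Theory Num.Theory.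
Import numFieldNormedType.Exports.
Local Open Scope classical_set_scope.
Local Open Scope ring_scope.

(* F is convex along every coupling, not only along optimal ones: for random
   vectors f and g,
     F(law((1-t)f+tg)) <= (1-t)F(law f) + tF(law g) - Lambda/2 t(1-t) E|f-g|^2.
   By continuity f and g may be taken finitely valued, and since d >= 2 a small
   perturbation of their values makes the segments joining the atoms
   X_i(s) = (1-s)X_i + sY_i pairwise disjoint at equal times.  When |s-s'| is
   small, X_i(s') is then the atom nearest to X_i(s), so moving each atom along
   its segment is optimal: the curve of laws is locally a W2-geodesic, F is
   locally Lambda-convex along it, and local convexity is global.
   For (1), a geodesic from nu_0 to nu_1 is, up to a small error, the
   interpolation of a coupling of nu_0 and nu_1; mixing that coupling with the
   diagonal coupling of mu multiplies its cost by h.  For (2), use instead the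
   Dirac mass at (y_0, y_1), divide by h and let h tend to 0. *)

(** * Euclidean norm and Borel sets of R^d *)

(** Plans are pairs of random vectors on an arbitrary probability space [T], so interpolating,
    rounding and perturbing act pointwise and every W2 estimate becomes a bound on [msq] of a
    difference. Infima are approached within e instead of attained, and plans are glued over
    finitely many cells of their common marginal, with a product measure inside each cell; this
    replaces optimal plans and disintegration. The dimension enters through collisions. On the line,
    two atoms that exchange their order must meet. In the first two coordinates, the relative
    position of two atoms runs along the segment from X_i - X_j to Y_i - Y_j; it stays away from 0
    as soon as these two vectors are linearly independent there, which is the nonvanishing of a
    polynomial in the size of the perturbation. Since the atoms are finitely many, a single lower
    bound on the distance of distinct atoms at equal times serves all pairs and all times. It yields
    a time step l independent of the time, and this uniformity is what passing from local to global
    convexity requires. *)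

Section euclidean.
Context (R : realType) (d : nat).
Implicit Types x y z : 'rV[R]_d.

Lemma sqr_enormE x : enorm x ^+ 2 = \sum_(i < d) x ord0 i ^+ 2.
Proof. by rewrite sqr_sqrtr// sumr_ge0// => i _; exact: sqr_ge0. Qed.

Lemma sqr_enormC x y : enorm (x - y) ^+ 2 = enorm (y - x) ^+ 2.
Proof.
by rewrite !sqr_enormE; apply: eq_bigr => i _; rewrite !mxE -sqrrN opprB.
Qed.

Lemma sqr_enorm0 : enorm (0 : 'rV[R]_d) ^+ 2 = 0.
Proof. by rewrite sqr_enormE big1// => i _; rewrite mxE expr0n. Qed.

Lemma sqr_enormZ (a : R) x : enorm (a *: x) ^+ 2 = a ^+ 2 * enorm x ^+ 2.
Proof.
by rewrite !sqr_enormE mulr_sumr; apply: eq_bigr => i _; rewrite mxE exprMn.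
Qed.

(** Young's inequality: the two sides differ by k^-1 |k x - y|^2. A small k keeps the coefficient of
    x close to 1, as continuity of [msq] demands. *)
Lemma sqr_enormD_le (k : R) x y : 0 < k ->
  enorm (x + y) ^+ 2 <= (1 + k) * enorm x ^+ 2 + (1 + k^-1) * enorm y ^+ 2.
Proof.
move=> k0; rewrite !sqr_enormE !mulr_sumr -big_split/=.
apply: ler_sum => i _; rewrite mxE.
set u := x _ _; set v := y _ _.
have kV : k * k^-1 = 1 by rewrite divff// gt_eqF.
have : 0 <= k^-1 * (k * u - v) ^+ 2 by rewrite mulr_ge0 ?sqr_ge0// invr_ge0 ltW.
suff -> : k^-1 * (k * u - v) ^+ 2 =
  (1 + k) * u ^+ 2 + (1 + k^-1) * v ^+ 2 - (u + v) ^+ 2 by rewrite subr_ge0.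
by field; rewrite gt_eqF.
Qed.

Lemma sqr_enormD_le2 x y :
  enorm (x + y) ^+ 2 <= 2 * enorm x ^+ 2 + 2 * enorm y ^+ 2.
Proof. by have := @sqr_enormD_le 1 x y ltr01; rewrite invr1. Qed.

(** Stewart's identity. Integrated, it forces a point of a geodesic to lie near the interpolation of
    its end points; at z = 0 it gives the convexity of the squared norm. *)
Lemma sqr_enorm_barycenter (t : R) x y z :
  enorm (z - ((1 - t) *: x + t *: y)) ^+ 2 + t * (1 - t) * enorm (x - y) ^+ 2 =
  (1 - t) * enorm (x - z) ^+ 2 + t * enorm (z - y) ^+ 2.
Proof.
rewrite !sqr_enormE !mulr_sumr -!big_split/=.
by apply: eq_bigr => i _; rewrite !mxE; ring.
Qed.

End euclidean.

Section measurability.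
Context (R : realType) (d : nat) (dT : measure_display) (T : measurableType dT).
Local Notation Rd := (Rd R d).

Lemma measurable_coord (i : 'I_d) :
  measurable_fun [set: Rd] (fun x : Rd => (x : 'rV[R]_d) ord0 i).
Proof.
apply: (measurability _ (RGenOpens.measurableE R)) => _ [_ [a [b ->]] <-].
rewrite setTI; apply: sub_sigma_algebra.
by apply: open_comp => // x _; exact: coord_continuous.
Qed.

(* An open set is the countable union of the rational cubes it contains. *)
Lemma measurable_RdP (f : T -> Rd) :
  (forall i, measurable_fun [set: T] (fun t => (f t : 'rV[R]_d) ord0 i)) ->
  measurable_fun [set: T] f.
Proof.
move=> mf; apply: (measurability (@open 'rV[R]_d : set (set Rd))
  (erefl _)) => _ [U oU <-]; rewrite setTI.
pose box (c : 'rV[rat]_d * nat) : set 'rV[R]_d :=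
  [set x | forall i, `|x ord0 i - ratr (c.1 ord0 i)| < c.2.+1%:R^-1].
have -> : f @^-1` U = \bigcup_(c : 'rV[rat]_d * nat)
    (if `[< box c `<=` U >] then f @^-1` box c else set0).
  apply/seteqP; split=> [t Ut|t [c _]]; last first.
    by case: ifPn => // /asboolP cU fc; exact: cU.
  have /nbhs_ballP[e /= e0 eU] : nbhs (f t : 'rV[R]_d) U.
    by apply: open_nbhs_nbhs; split.
  (* Half of e, because the cube is centred at a rational point near [f t] and not at [f t]
     itself. *)
  have [k ke] : exists k : nat, k.+1%:R^-1 < e / 2.
    have [k] := ltr_add_invr (divr_gt0 e0 (ltr0n R 2)).
    by rewrite add0r => ?; exists k.
  have q i : {q : rat | `|(f t : 'rV[R]_d) ord0 i - ratr q| < k.+1%:R^-1}.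
    apply: cid; have : (f t : 'rV[R]_d) ord0 i - k.+1%:R^-1 <
        (f t : 'rV[R]_d) ord0 i + k.+1%:R^-1.
      by rewrite ltrD2l gtrN// invr_gt0.
    move=> /rat_in_itvoo[q]; rewrite in_itv/= => qk; exists q.
    by rewrite distrC ltr_distl.
  exists (\row_i sval (q i), k) => //; case: ifPn => [_|/asboolP[]].
    by move=> i /=; rewrite mxE; exact: (svalP (q i)).
  move=> x bx; apply: eU; split => // i j; rewrite ord1.
  have := bx j; rewrite /= mxE => xq; have fq := svalP (q j).
  rewrite /ball/= -[X in X - _](subrK (ratr (sval (q j)))) -addrA.
  rewrite (le_lt_trans (ler_normD _ _))// (splitr e) ltrD//.
    by rewrite (lt_trans fq).
  by rewrite distrC (lt_trans xq).
apply: countable_bigcupT_measurable => [|c]; first exact: countableP.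
case: ifPn => // _.
rewrite -[X in measurable X]setCK; apply: measurableC.
have -> : ~` (f @^-1` box c) = \bigcup_(i : 'I_d)
    ((fun t => `|(f t : 'rV[R]_d) ord0 i - ratr (c.1 ord0 i)|) @^-1`
       `[c.2.+1%:R^-1, +oo[).
  apply/seteqP; split => [t /= /existsNP[i /negP]|t [i _] /=].
    by rewrite -leNgt => fi; exists i => //=; rewrite in_itv/= fi.
  by rewrite in_itv/= andbT leNgt => /negP fi /(_ i).
apply: countable_bigcupT_measurable => [|i]; first exact: countableP.
rewrite -[X in measurable X]setTI; apply: measurableT_comp => //.
exact: measurable_funB.
Qed.

End measurability.

(** * Laws, mean squares and W2 *)

Section laws.
Context (R : realType) (d : nat) (dT : measure_display) (T : measurableType dT).
Local Notation Rd := (Rd R d).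
Implicit Types f g : T -> 'rV[R]_d.

Lemma measurable_rV_coord f i : measurable_fun [set: T] (f : T -> Rd) ->
  measurable_fun [set: T] (fun t => f t ord0 i).
Proof.
move=> mf.
exact: (measurableT_comp (@measurable_coord R d i) mf).
Qed.

Lemma measurable_rV_comb (a b : R) f g :
  measurable_fun [set: T] (f : T -> Rd) ->
  measurable_fun [set: T] (g : T -> Rd) ->
  measurable_fun [set: T] ((fun t => a *: f t + b *: g t) : T -> Rd).
Proof.
move=> mf mg; apply: measurable_RdP => i.
under eq_fun do rewrite !mxE.
by apply: measurable_funD; apply: measurable_funM => //;
  exact: measurable_rV_coord.
Qed.

Lemma measurable_rVB f g :
  measurable_fun [set: T] (f : T -> Rd) ->
  measurable_fun [set: T] (g : T -> Rd) ->
  measurable_fun [set: T] ((fun t => f t - g t) : T -> Rd).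
Proof.
move=> mf mg; have := measurable_rV_comb 1 (-1) mf mg.
by under eq_fun do rewrite scale1r scaleN1r.
Qed.

Lemma measurable_sqr_enorm_comp f : measurable_fun [set: T] (f : T -> Rd) ->
  measurable_fun [set: T] (fun t => enorm (f t) ^+ 2).
Proof.
move=> mf; apply/measurable_EFinP.
exact: (measurableT_comp (@measurable_sqr_enorm R d) mf).
Qed.

Definition has_law (P : probability T R) f (mu : probability Rd R) : Prop :=
  measurable_fun [set: T] (f : T -> Rd) /\
  forall A : set Rd, measurable A -> mu A = P (f @^-1` A).

Definition msq (P : probability T R) f : \bar R :=
  (\int[P]_t (enorm (f t) ^+ 2)%:E)%E.

Lemma msq_ge0 P f : (0 <= msq P f)%E.
Proof. by apply: integral_ge0 => t _; rewrite lee_fin sqr_ge0. Qed.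

End laws.

Section pushforward_probability.
Context (R : realType) (d1 d2 : measure_display).
Context (T : measurableType d1) (T' : measurableType d2).

Lemma exists_image_probability (P : probability T R) (f : T -> T') :
  measurable_fun [set: T] f ->
  exists Q : probability T' R, forall A, Q A = P (f @^-1` A).
Proof.
move=> mf; pose F : {mfun T >-> T'} :=
  HB.pack f (isMeasurableFun.Build _ _ _ _ _ mf).
by exists (distribution P F).
Qed.

Lemma ge0_integral_image (P : probability T R) (Q : probability T' R)
    (f : T -> T') (phi : T' -> \bar R) :
  measurable_fun [set: T] f ->
  (forall A, measurable A -> Q A = P (f @^-1` A)) ->
  measurable_fun [set: T'] phi -> (forall y, 0 <= phi y)%E ->
  (\int[Q]_y phi y = \int[P]_x phi (f x))%E.
Proof.
move=> mf QP mphi phi0; pose F : {mfun T >-> T'} :=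
  HB.pack f (isMeasurableFun.Build _ _ _ _ _ mf).
rewrite (@eq_measure_integral _ _ _ setT (distribution P F)).
  by rewrite ge0_integral_distribution.
by move=> A mA _; exact: QP.
Qed.

Lemma integral_comb_le (P : probability T R) (f g a b : T -> R) (k l m : R) :
  measurable_fun [set: T] f -> measurable_fun [set: T] g ->
  measurable_fun [set: T] a -> measurable_fun [set: T] b ->
  (forall t, 0 <= f t) -> (forall t, 0 <= g t) ->
  (forall t, 0 <= a t) -> (forall t, 0 <= b t) ->
  0 <= k -> 0 <= l -> 0 <= m ->
  (forall t, f t + k * g t <= l * a t + m * b t) ->
  (\int[P]_t (f t)%:E + k%:E * \int[P]_t (g t)%:E <=
   l%:E * \int[P]_t (a t)%:E + m%:E * \int[P]_t (b t)%:E)%E.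
Proof.
move=> mf mg ma mb f0 g0 a0 b0 k0 l0 m0 H.
rewrite -!ge0_integralZl//=; try (by apply/measurable_EFinP);
  try by move=> t _; rewrite lee_fin.
rewrite -!ge0_integralD//=; try (by move=> t _; rewrite lee_fin// mulr_ge0);
  try (by apply/measurable_EFinP => //; exact: measurable_funM).
apply: ge0_le_integral => //=.
- by move=> t _; rewrite lee_fin addr_ge0// mulr_ge0.
- by apply/measurable_EFinP/measurable_funD => //; exact: measurable_funM.
- by apply/measurable_EFinP/measurable_funD; exact: measurable_funM.
- by move=> t _; rewrite lee_fin.
Qed.

End pushforward_probability.

Section mean_square.
Context (R : realType) (d : nat) (dT : measure_display) (T : measurableType dT).
Local Notation Rd := (Rd R d).
Implicit Types f g a b : T -> 'rV[R]_d.
Variable P : probability T R.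

(** Two terms on the left are there for [sqr_enorm_barycenter]; with k = 0 the lemma serves every
    estimate of triangle type. *)
Lemma msq_comb_le f g a b (k l m : R) :
  measurable_fun [set: T] (f : T -> Rd) ->
  measurable_fun [set: T] (g : T -> Rd) ->
  measurable_fun [set: T] (a : T -> Rd) ->
  measurable_fun [set: T] (b : T -> Rd) ->
  0 <= k -> 0 <= l -> 0 <= m ->
  (forall t, enorm (f t) ^+ 2 + k * enorm (g t) ^+ 2 <=
             l * enorm (a t) ^+ 2 + m * enorm (b t) ^+ 2) ->
  (msq P f + k%:E * msq P g <= l%:E * msq P a + m%:E * msq P b)%E.
Proof.
by move=> mf mg ma mb k0 l0 m0 H; apply: integral_comb_le => //;
  try (by move=> t; exact: sqr_ge0); exact: measurable_sqr_enorm_comp.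
Qed.

Lemma msq_le2 f a b (l m A B : R) :
  measurable_fun [set: T] (f : T -> Rd) ->
  measurable_fun [set: T] (a : T -> Rd) ->
  measurable_fun [set: T] (b : T -> Rd) ->
  0 <= l -> 0 <= m ->
  (forall t, enorm (f t) ^+ 2 <=
             l * enorm (a t) ^+ 2 + m * enorm (b t) ^+ 2) ->
  (msq P a <= A%:E)%E -> (msq P b <= B%:E)%E ->
  (msq P f <= (l * A + m * B)%:E)%E.
Proof.
move=> mf ma mb l0 m0 H PA PB.
have := @msq_comb_le f f a b 0 l m mf mf ma mb (lexx _) l0 m0.
rewrite mul0e adde0 => /(_ _)/le_trans; apply.
  by move=> t; rewrite mul0r addr0.
by rewrite EFinD !EFinM leeD// lee_wpmul2l// lee_fin.
Qed.

Lemma msqB_le2 f g (A B : R) :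
  measurable_fun [set: T] (f : T -> Rd) ->
  measurable_fun [set: T] (g : T -> Rd) ->
  (msq P f <= A%:E)%E -> (msq P g <= B%:E)%E ->
  (msq P (fun t => f t - g t)%R <= (2 * A + 2 * B)%:E)%E.
Proof.
move=> mf mg; apply: msq_le2 => //; first exact: measurable_rVB.
move=> t; have := sqr_enormD_le2 (f t) (- g t).
by rewrite -scaleN1r sqr_enormZ sqrrN expr1n mul1r scaleN1r.
Qed.

Lemma msq_fin f : (msq P f < +oo)%E -> msq P f = (fine (msq P f))%:E.
Proof. by move=> f_fin; rewrite fineK// ge0_fin_numE// msq_ge0. Qed.

Lemma has_law_second_moment f mu : has_law P f mu -> second_moment mu = msq P f.
Proof.
move=> [mf fmu]; rewrite /second_moment (ge0_integral_image mf fmu)//.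
  exact: measurable_sqr_enorm.
by move=> y; rewrite lee_fin sqr_ge0.
Qed.

Lemma exists_law f : measurable_fun [set: T] (f : T -> Rd) ->
  (msq P f < +oo)%E -> exists mu : P2 R d, has_law P f mu.
Proof.
move=> mf f_fin; have [Q QP] := exists_image_probability P mf.
have Qf : has_law P f Q by split.
have Q2 : (second_moment Q < +oo)%E by rewrite (has_law_second_moment Qf).
by exists (MkP2 Q2).
Qed.

Lemma has_law_coupling f g (mu nu : probability Rd R) :
  has_law P f mu -> has_law P g nu ->
  exists2 gamma, coupling mu nu gamma &
    transport_cost gamma = msq P (fun t => f t - g t)%R.
Proof.
move=> [mf fmu] [mg gnu].
have mfg : measurable_fun [set: T] ((fun t => (f t, g t)) : T -> (Rd * Rd)%type).
  by apply/measurable_fun_pairP; split.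
have [G GP] := exists_image_probability P mfg.
exists G.
  move=> A mA; rewrite !GP fmu// gnu//; split; congr (P _);
  by apply/seteqP; split => t //= [].
rewrite /transport_cost (ge0_integral_image mfg (fun A _ => GP A))//; last first.
  by move=> p; rewrite lee_fin sqr_ge0.
apply/measurable_EFinP.
apply: (measurable_sqr_enorm_comp (f := fun p : Rd * Rd => (p.1 - p.2 : 'rV[R]_d))).
by apply: measurable_rVB.
Qed.

Lemma coupling_has_law (mu nu : probability Rd R) gamma : coupling mu nu gamma ->
  has_law gamma (fst : Rd * Rd -> Rd) mu /\ has_law gamma (snd : Rd * Rd -> Rd) nu.
Proof.
move=> c; split; split => // A mA; have [cmu cnu] := c _ mA;
  rewrite -?cmu -?cnu; congr (gamma _); by apply/seteqP; split => t //= [].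
Qed.

Lemma sqr_W2_le f g (mu nu : P2 R d) (e : R) :
  has_law P f mu -> has_law P g nu ->
  (msq P (fun t => f t - g t)%R <= e%:E)%E -> W2 mu nu ^+ 2 <= e.
Proof.
move=> fmu gnu fge; have [G cG costG] := has_law_coupling fmu gnu.
rewrite /W2; set I := ereal_inf _.
have I0 : (0 <= I)%E.
  apply/ereal_infP => _ [H _ <-].
  by apply: integral_ge0 => p _; rewrite lee_fin sqr_ge0.
have Ie : (I <= e%:E)%E.
  by apply: le_trans fge; rewrite -costG; apply: ereal_inf_lbound; exists G.
have Ifin : I \is a fin_num by rewrite ge0_fin_numE// (le_lt_trans Ie)// ltry.
by rewrite sqr_sqrtr ?fine_ge0// -lee_fin fineK.
Qed.

(** The coupling given by f and g makes the infimum finite; otherwise [fine] would send +oo to 0 and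
    a positive c would violate the bound. *)
Lemma le_sqr_W2 (c : R) f g (mu nu : P2 R d) :
  has_law P f mu -> has_law P g nu -> (msq P (fun t => f t - g t)%R < +oo)%E ->
  (forall gamma, coupling mu nu gamma -> c%:E <= transport_cost gamma)%E ->
  c <= W2 mu nu ^+ 2.
Proof.
move=> fmu gnu fgoo cle; have [G cG costG] := has_law_coupling fmu gnu.
rewrite /W2; set I := ereal_inf _.
have I0 : (0 <= I)%E.
  apply/ereal_infP => _ [H _ <-].
  by apply: integral_ge0 => p _; rewrite lee_fin sqr_ge0.
have cI : (c%:E <= I)%E.
  by apply/ereal_infP => _ [H cH <-]; exact: cle.
have Ifin : I \is a fin_num.
  rewrite ge0_fin_numE//; apply: le_lt_trans fgoo; rewrite -costG.
  by apply: ereal_inf_lbound; exists G.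
by rewrite sqr_sqrtr ?fine_ge0// -lee_fin fineK.
Qed.

Lemma exists_coupling_near_W2 f g (mu nu : P2 R d) (e : R) : 0 < e ->
  has_law P f mu -> has_law P g nu -> (msq P (fun t => f t - g t)%R < +oo)%E ->
  exists2 gamma, coupling mu nu gamma &
    (transport_cost gamma <= (W2 mu nu ^+ 2 + e)%:E)%E.
Proof.
move=> e0 fmu gnu fgoo.
apply: contrapT => H.
have : W2 mu nu ^+ 2 + e <= W2 mu nu ^+ 2.
  apply: (le_sqr_W2 fmu gnu fgoo) => G cG; rewrite leNgt; apply/negP => GW.
  by apply: H; exists G => //; exact: ltW.
by rewrite gerDl leNgt e0.
Qed.

End mean_square.

(** * Local convexity implies convexity *)

Section local_convexity.
Context (R : realType).

Definition convex_upto (f : R -> R) (l : R) : Prop :=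
  forall a b x, 0 <= a -> a <= x -> x <= b -> b <= 1 -> b - a <= l ->
    (b - a) * f x <= (b - x) * f a + (x - a) * f b.

(* Combine the inequalities on the first and the last two thirds of [a, b]. *)
Lemma convex_upto_step (f : R -> R) (l : R) :
  convex_upto f l -> convex_upto f (3 / 2 * l).
Proof.
move=> fl a b x a0 ax xb b1 bal.
set L := b - a in bal *.
have L0 : 0 <= L by rewrite /L; lra.
have bE : b = a + L by rewrite /L; lra.
have [L0'|Lpos] := eqVneq L 0.
  have xa : x = a by lra.
  have ba : b = a by lra.
  by rewrite L0' xa ba !subrr !mul0r addr0.
have {}Lpos : 0 < L by rewrite lt_neqAle eq_sym Lpos.
move: {L0} L bE bal Lpos => L bE bal Lpos.
(* p is the midpoint of [a, q] and q that of [p, b]. Both intervals have length 2L/3, at most l,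
   whence the factor 3/2. Solving the two midpoint inequalities bounds f at p and q by the chord
   over [a, b]. *)
have [p pE] : exists p, p = a + L / 3 by exists (a + L / 3).
have [q qE] : exists q, q = a + 2 * L / 3 by exists (a + 2 * L / 3).
have Hp := fl a q p ltac:(lra) ltac:(lra) ltac:(lra) ltac:(lra) ltac:(lra).
have Hq := fl p b q ltac:(lra) ltac:(lra) ltac:(lra) b1 ltac:(lra).
have {}Hp : 2 * f p <= f a + f q.
  have L3 : 0 < L / 3 by rewrite divr_gt0.
  by rewrite -(ler_pM2l L3); move: Hp; rewrite pE qE; lra.
have {}Hq : 2 * f q <= f p + f b.
  have L3 : 0 < L / 3 by rewrite divr_gt0.
  by rewrite -(ler_pM2l L3); move: Hq; rewrite pE qE bE; lra.
have fp : f p <= (2 * f a + f b) / 3 by lra.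
have fq : f q <= (f a + 2 * f b) / 3 by lra.
have [xp|px] := leP x p.
  have H := fl a p x a0 ax xp ltac:(lra) ltac:(lra).
  have xa : 0 <= x - a by lra.
  have H2 := ler_wpM2l xa fp.
  by move: H H2; rewrite pE bE; lra.
have [xq|qx] := leP x q.
  have H := fl p q x ltac:(lra) (ltW px) xq ltac:(lra) ltac:(lra).
  have qx : 0 <= q - x by lra.
  have xp : 0 <= x - p by lra.
  have H2 := ler_wpM2l qx fp.
  have H3 := ler_wpM2l xp fq.
  by move: H H2 H3; rewrite pE qE bE; lra.
have H := fl q b x ltac:(lra) (ltW qx) xb ltac:(lra) ltac:(lra).
have bx : 0 <= b - x by lra.
have H2 := ler_wpM2l bx fq.
by move: H H2; rewrite qE bE; lra.
Qed.

Lemma convex_upto_le (f : R -> R) (l l' : R) :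
  l' <= l -> convex_upto f l -> convex_upto f l'.
Proof.
by move=> ll fl a b x a0 ax xb b1 bal; apply: fl => //; exact: le_trans ll.
Qed.

Lemma convex_upto_global (f : R -> R) (l : R) :
  0 < l -> convex_upto f l -> convex_upto f 1.
Proof.
move=> l0 fl.
(* Bernoulli's lower bound for (3/2)^n; linear growth is enough to exceed 1. *)
have H n : convex_upto f (l * (1 + n%:R / 2)).
  elim: n => [|n IH]; first by rewrite mul0r addr0 mulr1.
  apply: convex_upto_le (convex_upto_step IH).
  rewrite mulrCA ler_pM2l// -natr1.
  by have : 0 <= n%:R :> R := ler0n _ _; lra.
have [n nl] : exists n : nat, 1 <= l * (1 + n%:R / 2).
  exists (Num.bound (2 / l)); have := archi_boundP (ltW (divr_gt0 (ltr0n R 2) l0)).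
  rewrite ltr_pdivrMr// => H2.
  by rewrite mulrDr mulr1; move: H2; set k := _%:R; lra.
exact: convex_upto_le nl (H n).
Qed.

(** The parabola K s^2 has exactly the convexity defect K r (1 - r) (a - b)^2, so subtracting it
    from g reduces the claim to plain convexity. *)
Lemma local_strong_convexity (g : R -> R) (K l : R) : 0 < l ->
  (forall a b r, 0 <= a <= 1 -> 0 <= b <= 1 -> `|a - b| <= l -> 0 <= r <= 1 ->
    g ((1 - r) * a + r * b) <=
      (1 - r) * g a + r * g b - K * (r * (1 - r)) * (a - b) ^+ 2) ->
  forall r, 0 <= r <= 1 ->
    g r <= (1 - r) * g 0 + r * g 1 - K * (r * (1 - r)).
Proof.
move=> l0 gl r /andP[r0 r1].
have : convex_upto (fun s => g s - K * s ^+ 2) l.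
  move=> a b x a0 ax xb b1 bal.
  have [ab|ab] := eqVneq a b.
    by rewrite (_ : x = a) ?ab ?subrr ?mul0r ?addr0//; lra.
  have ba : 0 < b - a by rewrite subr_gt0 lt_neqAle ab (le_trans ax).
  have t01 : 0 <= (x - a) / (b - a) <= 1.
    by rewrite divr_ge0 ?subr_ge0 ?(le_trans ax)//= ler_pdivrMr// mul1r lerD2r.
  have := gl a b _ ltac:(lra) ltac:(lra) _ t01.
  rewrite distrC ger0_norm ?(ltW ba)// => /(_ bal).
  set s := (x - a) / (b - a).
  have sx : s * (b - a) = x - a by rewrite /s divfK// gt_eqF.
  have -> : (1 - s) * a + s * b = x by lra.
  move=> H; have := ler_wpM2l (ltW ba) H.
  have -> : (x - a) = s * (b - a) by [].
  have -> : (b - x) = (1 - s) * (b - a) by lra.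
  have -> : x = a + s * (b - a) by lra.
  by move=> H2; rewrite -subr_ge0; move: H2; rewrite -subr_ge0; nra.
move=> /(convex_upto_global l0)/(_ 0 1 r (lexx _) r0 r1 (lexx _)).
rewrite !subr0 => /(_ (lexx _)).
by rewrite expr0n expr1n/= !mulr0; nra.
Qed.

End local_convexity.

(** * Generic positions of segments *)

Section noncrossing.
Context (R : realType) (d : nat) (I : finType).
Hypothesis hd : (2 <= d)%N.
Implicit Types X Y : I -> 'rV[R]_d.

Let k0 : 'I_d := Ordinal (ltn_trans (ltnSn 0) hd).
Let k1 : 'I_d := Ordinal hd.

Definition segment_pt X Y (s : R) (i : I) : 'rV[R]_d :=
  (1 - s) *: X i + s *: Y i.

Let det2 (u v : 'rV[R]_d) : R :=
  u ord0 k0 * v ord0 k1 - u ord0 k1 * v ord0 k0.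

Lemma sqr_enorm_ge2 (w : 'rV[R]_d) :
  w ord0 k0 ^+ 2 + w ord0 k1 ^+ 2 <= enorm w ^+ 2.
Proof.
rewrite sqr_enormE (bigD1 k0)//= (bigD1 k1)//= addrA lerDl.
by apply: sumr_ge0 => i _; exact: sqr_ge0.
Qed.

(** Every point w of the line through u and v satisfies det2 w (v - u) = det2 u v, and Lagrange's
    identity bounds the square of this by |w|^2 |v - u|^2 in the first two coordinates. The constant
    D^2 / q is the squared distance from the origin to the projected line. *)
Lemma segment_away_from_0 (u v : 'rV[R]_d) : det2 u v != 0 ->
  exists2 c : R, 0 < c & forall s, c <= enorm ((1 - s) *: u + s *: v) ^+ 2.
Proof.
move=> D0; set D := det2 u v in D0.
pose q := (v ord0 k1 - u ord0 k1) ^+ 2 + (v ord0 k0 - u ord0 k0) ^+ 2.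
have key (w0 w1 : R) : w0 * (v ord0 k1 - u ord0 k1) -
    w1 * (v ord0 k0 - u ord0 k0) = D -> D ^+ 2 <= (w0 ^+ 2 + w1 ^+ 2) * q.
  move=> <-; rewrite -subr_ge0 /q.
  set a := v _ _ - _; set b := v _ _ - _.
  have -> : (w0 ^+ 2 + w1 ^+ 2) * (a ^+ 2 + b ^+ 2) - (w0 * a - w1 * b) ^+ 2 =
    (w0 * b + w1 * a) ^+ 2 by ring.
  exact: sqr_ge0.
have D2 : 0 < D ^+ 2 by rewrite exprn_even_gt0.
have q0 : 0 < q.
  rewrite lt_neqAle addr_ge0 ?sqr_ge0// andbT; apply/negP => /eqP q0.
  have : D ^+ 2 <= (u ord0 k0 ^+ 2 + u ord0 k1 ^+ 2) * q.
    by apply: key; rewrite /D /det2; ring.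
  by rewrite -q0 mulr0 leNgt D2.
exists (D ^+ 2 / q) => [|s]; first exact: divr_gt0.
rewrite ler_pdivrMr//; apply: le_trans (ler_wpM2r (ltW q0) (sqr_enorm_ge2 _)).
by apply: key; rewrite !mxE /D /det2; ring.
Qed.

(** The [size p] distinct candidates e / (k + 1) outnumber the roots that p can have. *)
Lemma nonroot_small (p : {poly R}) (e : R) : p != 0 -> 0 < e ->
  exists2 x, 0 < x <= e & p.[x] != 0.
Proof.
move=> p0 e0; apply: contrapT => H.
pose rs := [seq e / k.+1%:R | k <- iota 0 (size p)].
have := @max_poly_roots _ p rs p0; rewrite size_map size_iota ltnn.
suff [-> ->] : all (root p) rs /\ uniq rs by move=> /(_ isT isT).
split.
  apply/allP => _ /mapP[k _ ->]; apply: contrapT => /negP pk; apply: H.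
  exists (e / k.+1%:R) => //; rewrite divr_gt0//= ler_pdivrMr// ler_peMr ?ler1n//.
  exact: ltW.
rewrite map_inj_uniq ?iota_uniq// => i j /(mulfI (lt0r_neq0 e0))/invr_inj/eqP.
by rewrite eqr_nat eqSS => /eqP.
Qed.

(** Distinct shift factors for distinct atoms, so that the leading coefficient (rk i - rk j)^2 of
    the polynomials below is nonzero. *)
Let rk (i : I) : R := (enum_rank i)%:R.

Let rk_inj : injective rk.
Proof.
by move=> i j /eqP; rewrite eqr_nat => /eqP/val_inj/enum_rank_inj.
Qed.

(* Shifting the starting points along one axis and the end points along another
   makes det2 (X i - X j) (Y i - Y j) a polynomial of degree two in the size of
   the shift; hence only finitely many sizes are bad. *)
Lemma generic_perturbation X Y (e : R) : 0 < e ->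
  exists X' Y', [/\ forall i, enorm (X' i - X i) ^+ 2 <= e,
    forall i, enorm (Y' i - Y i) ^+ 2 <= e &
    forall i j, i != j -> det2 (X' i - X' j) (Y' i - Y' j) != 0].
Proof.
move=> e0.
pose p i j : {poly R} :=
  let r := (rk i - rk j)%:P in
  (r * 'X + (X i ord0 k0 - X j ord0 k0)%:P) *
  (r * 'X + (Y i ord0 k1 - Y j ord0 k1)%:P) -
  ((X i ord0 k1 - X j ord0 k1) * (Y i ord0 k0 - Y j ord0 k0))%:P.
have pE i j x : (p i j).[x] = ((rk i - rk j) * x + (X i ord0 k0 - X j ord0 k0)) *
    ((rk i - rk j) * x + (Y i ord0 k1 - Y j ord0 k1)) -
    (X i ord0 k1 - X j ord0 k1) * (Y i ord0 k0 - Y j ord0 k0).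
  rewrite /p; set r := rk i - _; set a := X i _ _ - _; set b := Y i _ _ - _.
  by set c := (_ * _ : R); rewrite !(hornerD, hornerN, hornerM, hornerX, hornerC).
(* A nonroot of the product is a good size for all pairs at once. *)
pose P := \prod_(ij : I * I | ij.1 != ij.2) p ij.1 ij.2.
have P0 : P != 0.
  apply/prodf_neq0 => -[i j] /= ij.
  have r0 : rk i - rk j != 0 by rewrite subr_eq0 (inj_eq rk_inj).
  apply/negP => /eqP pij0.
  (* The second difference of the values at -1, 0 and 1 is 2 (rk i - rk j)^2. *)
  have h x : (p i j).[x] = 0 by rewrite pij0 horner0.
  have := h 0; have := h 1; have := h (-1); rewrite !pE.
  move: (rk i - rk j) r0 => r r0 h1 h2 h3; have : r ^+ 2 = 0 by lra.
  by move/eqP; rewrite sqrf_eq0 (negPf r0).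
(* N exceeds all ranks; with x <= 1 and x <= e / N^2, every squared shift is at most x^2 N^2 <= x
   N^2 <= e. *)
pose N : R := #|I|%:R + 1.
have N1 : 1 <= N by rewrite lerDr.
have N0 : 0 < N by exact: lt_le_trans N1.
have e1 : 0 < Num.min 1 (e / N ^+ 2).
  by rewrite lt_min ltr01 divr_gt0// exprn_gt0.
have [x /andP[x0 xe] Px] := nonroot_small P0 e1.
have xrk i : (x * rk i) ^+ 2 <= e.
  have : x ^+ 2 <= e / N ^+ 2.
    move: xe; rewrite le_min => /andP[x1]; apply: le_trans.
    by rewrite expr2 ler_piMl// ltW.
  rewrite ler_pdivlMr ?exprn_gt0// exprMn; apply: le_trans.
  rewrite ler_wpM2l ?sqr_ge0// ler_sqr ?nnegrE ?(ltW N0) /rk ?ler0n//.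
  by rewrite /N natr1 ler_nat leqW// ltnW.
pose s k (i : I) : 'rV[R]_d := (x * rk i) *: delta_mx ord0 k.
have sle k i : enorm (s k i) ^+ 2 <= e.
  rewrite sqr_enormZ sqr_enormE (bigD1 k)//= big1 => [|l lk].
    by rewrite mxE !eqxx expr1n addr0 mulr1.
  by rewrite mxE eqxx (negPf lk) expr0n.
exists (fun i => X i + s k0 i), (fun i => Y i + s k1 i); split.
- by move=> i; rewrite addrC addKr.
- by move=> i; rewrite addrC addKr.
move=> i j ij; move: Px; rewrite /P horner_prod => /prodf_neq0/(_ (i, j) ij)/=.
rewrite pE /det2 !mxE !eqxx/=.
by apply: contra => /eqP H; apply/eqP; rewrite -[RHS]H; ring.
Qed.

Lemma finite_lower_bound (A : finType) (Q : A -> R -> Prop) :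
  (forall a c c', c' <= c -> Q a c -> Q a c') ->
  (forall a, exists2 c, 0 < c & Q a c) ->
  exists2 c, 0 < c & forall a, Q a c.
Proof.
move=> Qle Qex; have [c cQ] := choice (fun a => let: ex_intro2 c h k := Qex a in
  ex_intro (fun c => 0 < c /\ Q a c) c (conj h k)).
exists (\big[Num.min/1]_a c a).
  by elim/big_ind : _ => // [u v u0 v0|a _]; [rewrite lt_min u0|case: (cQ a)].
by move=> a; apply: (Qle a (c a)); [rewrite (bigD1 a)//= ge_min lexx|case: (cQ a)].
Qed.

Lemma noncrossing_perturbation X Y (e : R) : 0 < e ->
  exists X' Y', [/\ forall i, enorm (X' i - X i) ^+ 2 <= e,
    forall i, enorm (Y' i - Y i) ^+ 2 <= e &
    exists2 l : R, 0 < l & forall s s', `|s - s'| <= l -> forall i j,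
      enorm (segment_pt X' Y' s i - segment_pt X' Y' s' i) ^+ 2 <=
      enorm (segment_pt X' Y' s i - segment_pt X' Y' s' j) ^+ 2].
Proof.
move=> e0; have [X' [Y' [XX' YY' D]]] := generic_perturbation X Y e0.
exists X', Y'; split => //.
have [c c0 cP] : exists2 c : R, 0 < c & forall ij : I * I, ij.1 != ij.2 ->
    forall s, c <= enorm (segment_pt X' Y' s ij.1 - segment_pt X' Y' s ij.2) ^+ 2.
  apply: finite_lower_bound => [ij a b ba H /H{}H s|[i j]/=].
    exact: le_trans (H s).
  have [->|ij] := eqVneq i j; first by exists 1.
  have [c c0 cP] := segment_away_from_0 (D _ _ ij).
  exists c => // _ s; apply: le_trans (cP s) _; rewrite /segment_pt.
  by rewrite !scalerBr opprD addrACA.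
pose L : R := \sum_i enorm (X' i - Y' i) ^+ 2.
have L0 : 0 <= L by apply: sumr_ge0 => i _; exact: sqr_ge0.
have XYL i : enorm (X' i - Y' i) ^+ 2 <= L.
  rewrite /L (bigD1 i)//= lerDl.
  by apply: sumr_ge0 => j _; exact: sqr_ge0.
have sL s s' i : enorm (segment_pt X' Y' s i - segment_pt X' Y' s' i) ^+ 2 <=
    (s - s') ^+ 2 * L.
  have -> : segment_pt X' Y' s i - segment_pt X' Y' s' i =
      (s' - s) *: (X' i - Y' i).
    by rewrite /segment_pt; apply/rowP => k; rewrite !mxE; ring.
  by rewrite sqr_enormZ -sqrrN opprB ler_wpM2l ?sqr_ge0.
(* In this time an atom moves by at most c / 4 in squared distance: the bound 1 gives (s - s')^2 <=
   |s - s'|, and L + 1 is positive even if L = 0. Distinct atoms are c apart at equal times, so c <=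
   2 A + c / 2 for the squared distance A at times s and s', hence A >= c / 4. *)
exists (Num.min 1 (c / (4 * (L + 1)))).
  by rewrite lt_min ltr01 divr_gt0// mulr_gt0// ltr_wpDl.
move=> s s'; rewrite le_min => /andP[s1 sc] i j.
have [->//|ij] := eqVneq i j.
have s2 : (s - s') ^+ 2 * L <= c / 4.
  move: sc; rewrite ler_pdivlMr ?mulr_gt0 ?ltr_wpDl// => sc.
  have u0 := normr_ge0 (s - s'); rewrite -[X in X * _]real_normK ?num_real//.
  move: (`|s - s'|) u0 s1 sc => u u0 u1 sc.
  have : u ^+ 2 * L <= u * L by rewrite ler_wpM2r// expr2 ler_piMl.
  by lra.
have := sqr_enormD_le2 (segment_pt X' Y' s i - segment_pt X' Y' s' j)
  (segment_pt X' Y' s' j - segment_pt X' Y' s j).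
rewrite addrA subrK => H; have := cP (i, j) ij s => /= H1.
have := sL s s' i; have := sL s' s j.
by rewrite -(opprB s s') sqrrN; lra.
Qed.

End noncrossing.

(** * Quantization *)

Section finite_cells.
Context (R : realType) (d : nat) (dT : measure_display) (T : measurableType dT).
Context (I : finType).
Local Notation Rd := (Rd R d).

(** Measurability for the discrete sigma-algebra on [I], stated on fibres so that [I] can remain a
    bare finite type. *)
Definition finite_cells (q : T -> I) : Prop :=
  forall i, measurable (q @^-1` [set i]).

Lemma finite_cells_preimage (q : T -> I) (A : set I) :
  finite_cells q -> measurable (q @^-1` A).
Proof.
move=> mq.
have -> : q @^-1` A = \bigcup_(i : I)
    (if `[< A i >] then q @^-1` [set i] else set0).
  apply/seteqP; split => [t At|t [i _]]; last first.
    by case: ifPn => // /asboolP Ai /= ->.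
  by exists (q t) => //; case: ifPn => // /asboolP.
apply: countable_bigcupT_measurable => [|i]; first exact: countableP.
by case: ifPn.
Qed.

Lemma measurable_finite_cells (q : T -> I) (c : I -> 'rV[R]_d) :
  finite_cells q -> measurable_fun [set: T] ((fun t => c (q t)) : T -> Rd).
Proof.
move=> mq _ A mA; rewrite setTI.
exact: (finite_cells_preimage (c @^-1` A)).
Qed.

End finite_cells.

Section quantization.
Context (R : realType).

(** The count is the integer part of y clamped to [0, K]. As a sum of booleans it depends only on
    finitely many threshold tests, and these are what a cell records. *)
Lemma count_thresholds (y : R) (K : nat) :
  let N := (\sum_(k < K) (k.+1%:R <= y)%R)%N in
  [/\ K%:R <= y -> N = K, 0 <= y <= K%:R -> N%:R <= y <= N%:R + 1
    & y < 0 -> N = 0%N].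
Proof.
elim: K => [|K [IH1 IH2 IH3]] /=.
  rewrite big_ord0; split => // /andP[y0 y1].
  by rewrite y0 (le_trans y1)// lerDl.
rewrite big_ord_recr/=; set N := (\sum_(k < K) _)%N in IH1 IH2 IH3 *.
split.
- move=> Ky; rewrite Ky IH1 ?addn1//; apply: le_trans Ky.
  by rewrite ler_nat.
- move=> /andP[y0 yK].
  have [yKK|yK1] := leP K.+1%:R y.
    rewrite IH1 ?addn1; last by apply: le_trans yKK; rewrite ler_nat.
    by rewrite yKK/= (le_trans yK)// lerDl.
  have [yKK|yKK] := leP K%:R y.
    by rewrite addn0 IH1// yKK/= natr1.
  by rewrite addn0; apply: IH2; rewrite y0 ltW.
- move=> y0; rewrite IH3// leNgt (lt_trans y0)//.
Qed.

(** c is x clamped to [-(n+1), n+1] and rounded down to a grid of step 1 / (n+1), which has 2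
    (n+1)^2 steps. The first bound gives pointwise convergence, the second, uniform in n,
    domination. *)
Lemma quantize1 (n : nat) (x : R) :
  let c := - n.+1%:R +
    (\sum_(k < 2 * n.+1 * n.+1)
      (k.+1%:R <= (x + n.+1%:R) * n.+1%:R)%R)%N%:R / n.+1%:R in
  (`|x| <= n.+1%:R -> (x - c) ^+ 2 <= n.+1%:R^-1) /\
  (x - c) ^+ 2 <= 2 * x ^+ 2 + 2.
Proof.
move=> c; rewrite /c {c}; set m : R := n.+1%:R.
have m1 : 1 <= m by rewrite ler1n.
have m0 : 0 < m by exact: lt_le_trans m1.
have [] := count_thresholds ((x + m) * m) (2 * n.+1 * n.+1).
set N := (\sum_(k < _) _)%N.
have -> : (2 * n.+1 * n.+1)%:R = 2 * m * m :> R by rewrite !natrM.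
move=> H1 H2 H3.
have S : `|x| <= m -> (x - (- m + N%:R / m)) ^+ 2 <= m^-1.
  rewrite ler_norml => /andP[xm mx].
  have /H2 : 0 <= (x + m) * m <= 2 * m * m.
    by rewrite mulr_ge0 ?(ltW m0)//= ?ler_pM2r//; lra.
  move=> /andP[Ny yN].
  have v0 : 0 <= m^-1 by rewrite invr_ge0 ltW.
  have mv : m * m^-1 = 1 by rewrite divff// gt_eqF.
  have v1 : m^-1 <= 1 by rewrite invf_le1.
  have lo : 0 <= x - (- m + N%:R / m).
    by rewrite opprD opprK addrA subr_ge0 ler_pdivrMr.
  have hi : x - (- m + N%:R / m) <= m^-1.
    rewrite opprD opprK addrA lerBlDl.
    have -> : N%:R / m + m^-1 = (N%:R + 1) / m by rewrite mulrDl mul1r.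
    by rewrite ler_pdivlMr.
  rewrite expr2; apply: le_trans (ler_wpM2l lo hi) _.
  by rewrite -[leRHS]mul1r ler_wpM2r// (le_trans hi).
split=> //.
have [xm|xm] := leP `|x| m.
  apply: le_trans (S xm) _; apply: (@le_trans _ _ 1); first by rewrite invf_le1.
  by have := sqr_ge0 x; lra.
have [x0|x0] := leP 0 x.
  rewrite ger0_norm// in xm.
  have -> : N%:R / m = 2 * m.
    rewrite H1 ?natrM -?/m ?mulfK ?gt_eqF// ler_pM2r//; lra.
  by nra.
rewrite ltr0_norm// in xm.
have -> : N = 0%N by apply: H3; rewrite pmulr_llt0//; lra.
by rewrite mul0r addr0 opprK; nra.
Qed.

End quantization.

Section quantization_Rd.
Context (R : realType) (d : nat).
Local Notation Rd := (Rd R d).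

(** Dominated convergence along finer and wider grids; the dominating function 2 |x|^2 + 2 d is
    integrable because the second moment is finite. A cell is the table of outcomes of all threshold
    tests, so its complement is a finite union of half-spaces. *)
Lemma exists_quantization (mu : P2 R d) (e : R) : 0 < e ->
  exists (I : finType) (q : Rd -> I) (c : I -> 'rV[R]_d), finite_cells q /\
    (msq mu (fun x : Rd => ((x : 'rV[R]_d) - c (q x))%R) <= e%:E)%E.
Proof.
move=> e0.
pose I n : finType := {ffun 'I_d * 'I_(2 * n.+1 * n.+1) -> bool}.
pose q n (x : Rd) : I n := [ffun ik : 'I_d * 'I_(2 * n.+1 * n.+1) =>
  ik.2.+1%:R <= ((x : 'rV[R]_d) ord0 ik.1 + n.+1%:R) * n.+1%:R].
pose c n (f : I n) : 'rV[R]_d := \row_i (- n.+1%:R +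
  (\sum_(k < 2 * n.+1 * n.+1) f (i, k))%N%:R / n.+1%:R).
have mq n : finite_cells (q n).
  move=> f; rewrite -[X in measurable X]setCK; apply: measurableC.
  have -> : ~` (q n @^-1` [set f]) = \bigcup_(ik : 'I_d * 'I_(2 * n.+1 * n.+1))
     ((fun x : Rd => ik.2.+1%:R <=
        ((x : 'rV[R]_d) ord0 ik.1 + n.+1%:R) * n.+1%:R) @^-1` [set ~~ f ik]).
    apply/seteqP; split => [x /= qf|x [ik _ /= qik] qf].
      apply: contrapT => H; apply: qf; apply/ffunP => ik; rewrite ffunE.
      apply: contrapT => H2; apply: H; exists ik => //=.
      by move: H2; case: (f ik); case: (_ <= _).
    by move: qik; rewrite -qf ffunE; case: (_ <= _).
  apply: countable_bigcupT_measurable => [|ik]; first exact: countableP.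
  rewrite -[X in measurable X]setTI.
  apply: measurable_fun_ler => //; apply: measurable_funM => //.
  by apply: measurable_funD => //; exact: measurable_coord.
pose f_ n (x : Rd) : \bar R := (enorm ((x : 'rV[R]_d) - c n (q n x)) ^+ 2)%:E.
pose g (x : Rd) : \bar R :=
  (2%:E * (enorm (x : 'rV[R]_d) ^+ 2)%:E + (2 * d%:R)%:E)%E.
have mf n : measurable_fun setT (f_ n).
  apply/measurable_EFinP; apply: measurable_sqr_enorm_comp.
  by apply: measurable_rVB => //; exact: measurable_finite_cells.
have fE n x : enorm ((x : 'rV[R]_d) - c n (q n x)) ^+ 2 =
  \sum_(i < d) (x ord0 i - (- n.+1%:R +
    (\sum_(k < 2 * n.+1 * n.+1)
      (k.+1%:R <= (x ord0 i + n.+1%:R) * n.+1%:R)%R)%N%:R / n.+1%:R)) ^+ 2.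
  rewrite sqr_enormE; apply: eq_bigr => i _; rewrite !mxE.
  by under eq_bigr do rewrite ffunE.
have f0 x n : (0 <= f_ n x)%E by rewrite lee_fin sqr_ge0.
have [] := @dominated_convergence _ _ _ mu setT measurableT f_ (cst 0%E) g.
- exact: mf.
- exact: measurable_cst.
- apply: aeW => x _.
  apply: (@squeeze_cvge _ _ _ _ (cst 0%E) _ (fun n => (d%:R / n.+1%:R)%:E)).
  + near=> n; rewrite /cst f0/= lee_fin fE.
    apply: (@le_trans _ _ (\sum_(i < d) n.+1%:R^-1)); last first.
      by rewrite sumr_const card_ord mulr_natl.
    apply: ler_sum => i _; have [H _] := quantize1 n ((x : 'rV[R]_d) ord0 i).
    apply: H; apply: (@le_trans _ _ (\sum_(j < d) `|(x : 'rV[R]_d) ord0 j|)).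
      by rewrite (bigD1 i)//= lerDl sumr_ge0.
    near: n; exists (Num.bound (\sum_(j < d) `|(x : 'rV[R]_d) ord0 j|)) => // k /= bk.
    apply: ltW; apply: lt_le_trans (archi_boundP _) _; first exact: sumr_ge0.
    by rewrite ler_nat (leq_trans bk).
  + exact: cvg_cst.
  + apply: cvg_EFin; first by near=> n.
    rewrite -[X in _ --> X](mulr0 d%:R); apply: cvgMr; exact: cvg_harmonic.
- apply/integrableP; split.
    apply: emeasurable_funD => //; apply: measurable_funeM.
    exact: measurable_sqr_enorm.
  under eq_integral.
    move=> x _; rewrite gee0_abs; last first.
      by rewrite /g -EFinM -EFinD lee_fin addr_ge0// mulr_ge0// sqr_ge0.
    over.
  rewrite ge0_integralD//; last 2 first.
  + by move=> x _; rewrite -EFinM lee_fin mulr_ge0// sqr_ge0.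
  + by apply: measurable_funeM; exact: measurable_sqr_enorm.
  rewrite ge0_integralZl//; last 2 first.
  + exact: measurable_sqr_enorm.
  + by move=> x _; rewrite lee_fin sqr_ge0.
  rewrite integral_cst// lte_add_pinfty//.
    by rewrite lte_mul_pinfty// P2_finite.
  apply: lte_mul_pinfty; rewrite ?lee_fin ?mulr_ge0//.
  by apply: (le_lt_trans (probability_le1 mu measurableT)); exact: ltry.
- apply: aeW => x n _; rewrite gee0_abs//.
  have -> : g x = (2 * enorm (x : 'rV[R]_d) ^+ 2 + 2 * d%:R)%:E by [].
  rewrite lee_fin fE sqr_enormE mulr_sumr.
  have -> : 2 * d%:R = \sum_(i < d) (2 : R).
    by rewrite sumr_const card_ord mulr_natr.
  rewrite -big_split/=; apply: ler_sum => i _.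
  by have [_] := quantize1 n ((x : 'rV[R]_d) ord0 i).
move=> _ _; rewrite integral0.
move=> /fine_cvgP[fin_f] /cvgrPdist_lt/(_ e e0) fe.
have [n _ /(_ n (leqnn _))] := filterI fin_f fe.
case=> /= fn; rewrite sub0r normrN => /(le_lt_trans (ler_norm _)) H.
exists (I n), (q n), (c n); split => //.
by rewrite /msq -[leLHS]fineK// lee_fin ltW.
Unshelve. all: by end_near. Qed.

End quantization_Rd.

(** * Gluing couplings *)

Section glue.
Context (R : realType) (d1 d2 : measure_display).
Context (T1 : measurableType d1) (T2 : measurableType d2) (I : finType).
Variables (mu1 : probability T1 R) (mu2 : probability T2 R).
Variables (q1 : T1 -> I) (q2 : T2 -> I).
Hypotheses (mq1 : finite_cells q1) (mq2 : finite_cells q2).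
Hypothesis q12 : forall i, mu1 (q1 @^-1` [set i]) = mu2 (q2 @^-1` [set i]).

Let B1 (k : nat) : set T1 := [set x | enum_rank (q1 x) = k :> nat].
Let B2 (k : nat) : set T2 := [set x | enum_rank (q2 x) = k :> nat].

Let mB1 k : measurable (B1 k).
Proof. exact: (finite_cells_preimage [set i | enum_rank i = k :> nat]). Qed.

Let mB2 k : measurable (B2 k).
Proof. exact: (finite_cells_preimage [set i | enum_rank i = k :> nat]). Qed.

Let B12 (k : 'I_#|I|) : mu1 (B1 k) = mu2 (B2 k).
Proof.
have E d (T : measurableType d) (q : T -> I) :
    [set x | enum_rank (q x) = k :> nat] = q @^-1` [set enum_val k].
  apply/seteqP; split => x /= => [/val_inj <-|->]; first by rewrite enum_rankK.
  by rewrite enum_valK.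
by rewrite /B1 /B2 !E.
Qed.

Let fibers_sum d (T : measurableType d) (P : probability T R) (q : T -> I)
    (A : set T) : finite_cells q -> measurable A ->
  P A = (\sum_(k < #|I|) P (A `&` [set x | enum_rank (q x) = k :> nat]))%E.
Proof.
move=> mq mA; pose F (k : nat) := A `&` [set x | enum_rank (q x) = k :> nat].
have mF k : measurable (F k).
  apply: measurableI => //.
  exact: (finite_cells_preimage [set i | enum_rank i = k :> nat]).
rewrite -(@measure_semi_additive _ _ _ P F #|I|)//.
- congr (P _); rewrite -bigcup_mkord; apply/seteqP; split=> [x Ax|x [k _ []//]].
  by exists (enum_rank (q x)); [exact: ltn_ord|split].
- by apply/trivIsetP => i j _ _ ij; apply/seteqP; split => // x [[_ /= xi] [_ /= xj]];
    move: ij; rewrite -xi -xj eqxx.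
- by apply: bigsetU_measurable.
Qed.

Let D (k : nat) := B1 k `*` B2 k.
Let mD k : measurable (D k). Proof. exact: measurableX. Qed.
Let w_ge0 (k : nat) : 0 <= (fine (mu1 (B1 k)))^-1.
Proof. by rewrite invr_ge0 fine_ge0. Qed.

(* Conditionally on the common cell, the two components are independent. *)
Let pi : set (T1 * T2) -> \bar R := msum (fun k =>
  mscale (NngNum (w_ge0 k)) (mrestr (mu1 \x mu2)%E (mD k))) #|I|.

HB.instance Definition _ := Measure.on pi.

Let piE A : pi A =
  (\sum_(k < #|I|) (fine (mu1 (B1 k)))^-1%:E * (mu1 \x mu2) (A `&` D k))%E.
Proof. by []. Qed.

(** Normalizing by the mass of a cell cancels. In a cell of mass zero the inverse is 0 by
    convention, and x is squeezed to 0 as well. *)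
Let weightE (k : 'I_#|I|) (x : \bar R) : (0 <= x <= mu1 (B1 k))%E ->
  ((fine (mu1 (B1 k)))^-1%:E * (x * mu1 (B1 k)) = x)%E.
Proof.
have Pfin : mu1 (B1 k) \is a fin_num by exact: fin_num_measure.
move: (mu1 (B1 k)) Pfin => [r| |]// _ /andP[].
case: x => [x| |]//= x0 xr; rewrite -!EFinM.
have [r0|r0] := eqVneq r 0.
  move: x0 xr; rewrite r0 !lee_fin => x0 xr.
  have -> : x = 0 by apply/eqP; rewrite eq_le xr x0.
  by rewrite mul0r mulr0.
by congr EFin; rewrite mulrCA mulVf// mulr1.
Qed.

Let pi1 (A : set T1) : measurable A -> pi (fst @^-1` A) = mu1 A.
Proof.
move=> mA; rewrite piE (fibers_sum mu1 mq1 mA); apply: eq_bigr => k _.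
have -> : fst @^-1` A `&` D k = (A `&` B1 k) `*` B2 k.
  by apply/seteqP; split => -[x y] /=; rewrite /D /= => -[]; tauto.
have -> : ((mu1 \x mu2) ((A `&` B1 k) `*` B2 k) =
    mu1 (A `&` B1 k) * mu1 (B1 k))%E.
  by rewrite B12; apply: product_measure1E => //; exact: measurableI.
rewrite weightE// measure_ge0/= le_measure// inE//.
exact: measurableI.
Qed.

Let pi2 (A : set T2) : measurable A -> pi (snd @^-1` A) = mu2 A.
Proof.
move=> mA; rewrite piE (fibers_sum mu2 mq2 mA); apply: eq_bigr => k _.
have -> : snd @^-1` A `&` D k = B1 k `*` (A `&` B2 k).
  by apply/seteqP; split => -[x y] /=; rewrite /D /= => -[]; tauto.
have -> : ((mu1 \x mu2) (B1 k `*` (A `&` B2 k)) =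
    mu2 (A `&` B2 k) * mu1 (B1 k))%E.
  by rewrite muleC; apply: product_measure1E => //; exact: measurableI.
rewrite weightE// measure_ge0/= B12 le_measure// inE//.
exact: measurableI.
Qed.

Let pi_setT : pi setT = 1%E.
Proof. by rewrite -(preimage_setT fst) pi1// probability_setT. Qed.

HB.instance Definition _ := Measure_isProbability.Build _ _ _ pi pi_setT.

Lemma exists_glued_probability : exists P : probability (T1 * T2)%type R,
  [/\ forall A, measurable A -> P (fst @^-1` A) = mu1 A,
      forall A, measurable A -> P (snd @^-1` A) = mu2 A &
      {ae P, forall p, q1 p.1 = q2 p.2}].
Proof.
exists pi; split => //.
exists (\bigcup_(ij : I * I) if ij.1 != ij.2
  then (q1 @^-1` [set ij.1]) `*` (q2 @^-1` [set ij.2]) else set0); split.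
- apply: countable_bigcupT_measurable => [|ij]; first exact: countableP.
  by case: ifPn => // _; exact: measurableX.
- rewrite [LHS]piE big1// => k _; set N := \bigcup_ij _.
  suff -> : N `&` D k = set0 by rewrite measure0 mule0.
  apply/seteqP; split => // -[x y] [[[i j] _ /=]].
  case: ifPn => // ij [/= xi yj] [/= xk yk].
  by move: ij; rewrite -xi -yj -(inj_eq enum_rank_inj) -val_eqE/= xk yk eqxx.
- move=> p /= pq; exists (q1 p.1, q2 p.2) => //=.
  by case: ifPn => //= /negPn/eqP.
Qed.

End glue.

(** * Laws and mean squares under measure-preserving maps *)

Section transfer.
Context (R : realType) (d : nat) (d1 d2 : measure_display).
Context (T1 : measurableType d1) (T2 : measurableType d2).
Local Notation Rd := (Rd R d).
Variables (P : probability T1 R) (Q : probability T2 R) (phi : T1 -> T2).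
Hypothesis mphi : measurable_fun [set: T1] phi.
Hypothesis phiE : forall A, measurable A -> P (phi @^-1` A) = Q A.

Lemma has_law_comp (f : T2 -> 'rV[R]_d) (mu : probability Rd R) :
  has_law Q f mu -> has_law P (f \o phi) mu.
Proof.
move=> [mf fmu]; split; first exact: (measurableT_comp (mf : measurable_fun _ (f : T2 -> Rd))).
by move=> A mA; rewrite fmu// -phiE// -[X in measurable X]setTI; exact: mf.
Qed.

Lemma msq_comp (f : T2 -> 'rV[R]_d) :
  measurable_fun [set: T2] (f : T2 -> Rd) -> msq P (f \o phi) = msq Q f.
Proof.
move=> mf; rewrite /msq [RHS](ge0_integral_image (f := phi) (P := P))//.
- by move=> A mA; rewrite phiE.
- by apply/measurable_EFinP; exact: measurable_sqr_enorm_comp.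
- by move=> y; rewrite lee_fin sqr_ge0.
Qed.

End transfer.

Section glue_couplings.
Context (R : realType) (d : nat).
Local Notation Rd := (Rd R d).

(** The common marginal is quantized and the plans are glued over its cells. The two middle
    components then almost surely share a cell, so their difference is that of their quantization
    remainders, each of mean square at most e / 4; doubling both gives e. *)
Lemma glue_couplings (mu0 mut mu1 : P2 R d)
    (g1 g2 : probability (Rd * Rd)%type R) (e : R) : 0 < e ->
  coupling mu0 mut g1 -> coupling mut mu1 g2 ->
  exists P : probability ((Rd * Rd) * (Rd * Rd))%type R,
    [/\ forall A, measurable A -> P (fst @^-1` A) = g1 A,
        forall A, measurable A -> P (snd @^-1` A) = g2 A &
        (msq P (fun p => (p.1.2 - p.2.1 : 'rV[R]_d)%R) <= e%:E)%E].
Proof.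
move=> e0 /coupling_has_law[_ g1t] /coupling_has_law[g2t _].
have [I [q [c [mq qe]]]] := exists_quantization mut (divr_gt0 e0 (ltr0n R 4)).
have mq1 : finite_cells (q \o snd : Rd * Rd -> I).
  by move=> i; rewrite -[X in measurable X]setTI; exact: (g1t.1 measurableT _ (mq i)).
have mq2 : finite_cells (q \o fst : Rd * Rd -> I).
  by move=> i; rewrite -[X in measurable X]setTI; exact: (g2t.1 measurableT _ (mq i)).
have q12 i : g1 ((q \o snd) @^-1` [set i]) = g2 ((q \o fst) @^-1` [set i]).
  exact: etrans (esym (g1t.2 _ (mq i))) (g2t.2 _ (mq i)).
have [P [P1 P2 Pq]] := exists_glued_probability mq1 mq2 q12.
exists P; split => //.
pose r (x : Rd) : 'rV[R]_d := (x : 'rV[R]_d) - c (q x).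
have mr : measurable_fun setT (r : Rd -> Rd).
  by apply: measurable_rVB => //; exact: measurable_finite_cells.
have m12 : measurable_fun setT ((fun p => p.1.2) : (Rd * Rd) * (Rd * Rd) -> Rd).
  by apply: (@measurableT_comp _ _ _ _ _ _ snd _ fst).
have m21 : measurable_fun setT ((fun p => p.2.1) : (Rd * Rd) * (Rd * Rd) -> Rd).
  by apply: (@measurableT_comp _ _ _ _ _ _ fst _ snd).
have m1 := measurableT_comp mr m12.
have m2 := measurableT_comp mr m21.
have E1 : (msq P (fun p => r p.1.2) <= (e / 4)%:E)%E.
  apply: le_trans qe; rewrite -(msq_comp g1t.1 (fun A mA => esym (g1t.2 A mA)) mr).
  rewrite -(msq_comp (phi := fst) measurable_fst P1)//.
  exact: (measurableT_comp mr measurable_snd).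
have E2 : (msq P (fun p => r p.2.1) <= (e / 4)%:E)%E.
  apply: le_trans qe; rewrite -(msq_comp g2t.1 (fun A mA => esym (g2t.2 A mA)) mr).
  rewrite -(msq_comp (phi := snd) measurable_snd P2)//.
  exact: (measurableT_comp mr measurable_fst).
have := msqB_le2 m1 m2 E1 E2; rewrite (_ : 2 * _ + _ = e); last by lra.
apply: le_trans; rewrite le_eqVlt; apply/orP; left; apply/eqP.
apply: ge0_ae_eq_integral => //.
- apply/measurable_EFinP; apply: measurable_sqr_enorm_comp.
  exact: measurable_rVB.
- by apply/measurable_EFinP/measurable_sqr_enorm_comp/measurable_rVB.
- by move=> p _; rewrite lee_fin sqr_ge0.
- by move=> p _; rewrite lee_fin sqr_ge0.
apply: filterS Pq => p /= pq _; rewrite /r pq.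
by rewrite opprB addrA subrK.
Qed.

End glue_couplings.

(** * Convexity along discrete plans *)

Section discrete_geodesics.
Context (R : realType) (d : nat) (dT : measure_display) (T : measurableType dT).
Context (I : finType).
Local Notation Rd := (Rd R d).
Variables (P : probability T R) (q : T -> I).
Hypothesis mq : finite_cells q.
Implicit Types X Y : I -> 'rV[R]_d.

Lemma msq_finite_cells (X : I -> 'rV[R]_d) : (msq P (fun t => X (q t)) < +oo)%E.
Proof.
have mX := measurable_finite_cells X mq.
apply: (@le_lt_trans _ _ (\int[P]_t (\sum_i enorm (X i) ^+ 2)%:E)%E).
  apply: ge0_le_integral => //.
  - by move=> t _; rewrite lee_fin sqr_ge0.
  - by apply/measurable_EFinP; exact: measurable_sqr_enorm_comp.
  move=> t _; rewrite lee_fin (bigD1 (q t))//= lerDl.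
  by apply: sumr_ge0 => i _; exact: sqr_ge0.
rewrite integral_cst//; apply: lte_mul_pinfty => //.
  by rewrite lee_fin; apply: sumr_ge0 => i _; exact: sqr_ge0.
by apply: (le_lt_trans (probability_le1 P measurableT)); exact: ltry.
Qed.

Lemma measurable_Rd_set1 (x : Rd) : measurable [set x].
Proof.
rewrite -[X in measurable X]setCK; apply: measurableC.
apply: sub_sigma_algebra; apply: closed_openC.
exact/(@accessible_closed_set1 'rV[R]_d)/hausdorff_accessible/norm_hausdorff.
Qed.

(* The identity coupling sends every atom to a nearest one. *)
Lemma sqr_W2_discrete X Y (mu nu : P2 R d) :
  has_law P (fun t => X (q t)) mu -> has_law P (fun t => Y (q t)) nu ->
  (forall i j, enorm (X i - Y i) ^+ 2 <= enorm (X i - Y j) ^+ 2) ->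
  (W2 mu nu ^+ 2)%:E = msq P (fun t => (X (q t) - Y (q t))%R).
Proof.
move=> Xmu Ynu near_XY.
have fin := msq_finite_cells (fun i => X i - Y i).
apply/eqP; rewrite eq_le; apply/andP; split.
  by rewrite (msq_fin fin) lee_fin (sqr_W2_le Xmu Ynu)// -(msq_fin fin).
rewrite (msq_fin fin) lee_fin; apply: (le_sqr_W2 Xmu Ynu fin) => G GXY.
rewrite -(msq_fin fin).
(* The starting value of the minimum in [phi]. It dominates every |X_i - Y_i|^2, so it does not push
   [phi (X i)] below the cost of the identity coupling. *)
pose K := \sum_i enorm (X i - Y i) ^+ 2.
(* A dual potential: up to the cap K, the squared distance to the nearest atom of nu. It bounds the
   cost from below G-almost everywhere, since the second component is almost surely some [Y j], and
   its integral depends on mu alone. *)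
pose phi (x : Rd) : R :=
  \big[Num.min/K]_j enorm ((x : 'rV[R]_d) - Y j) ^+ 2.
have K0 : 0 <= K by apply: sumr_ge0 => i _; exact: sqr_ge0.
have phi0 x : 0 <= phi x.
  by rewrite /phi; elim/big_ind : _ => // [a b a0 b0|i _];
    rewrite ?le_min ?a0 ?sqr_ge0.
have mphi : measurable_fun setT phi.
  rewrite /phi; elim: (index_enum I) => [|j s IH].
    by under eq_fun do rewrite big_nil; exact: measurable_cst.
  under eq_fun do rewrite big_cons.
  apply: measurable_minr => //; apply: measurable_sqr_enorm_comp.
  by apply: measurable_rVB => //; exact: measurable_cst.
have [G1 G2] := coupling_has_law GXY.
apply: (@le_trans _ _ (\int[P]_t (phi (X (q t)))%:E)%E).
  apply: ge0_le_integral => //.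
  - by move=> t _; rewrite lee_fin sqr_ge0.
  - apply/measurable_EFinP; apply: measurable_sqr_enorm_comp.
    exact: (measurable_finite_cells (fun i => X i - Y i)).
  - by apply/measurable_EFinP; exact: (measurableT_comp mphi Xmu.1).
  move=> t _; rewrite lee_fin /phi; elim/big_ind : _ => [|a b a0 b0|i _].
  - rewrite /K (bigD1 (q t))//= lerDl.
    by apply: sumr_ge0 => i _; exact: sqr_ge0.
  - by rewrite le_min a0.
  - exact: near_XY.
rewrite -(ge0_integral_image Xmu.1 Xmu.2 (phi := EFin \o phi)); last 2 first.
- exact/measurable_EFinP.
- by move=> x; rewrite lee_fin.
rewrite (ge0_integral_image G1.1 G1.2); last 2 first.
- exact/measurable_EFinP.
- by move=> x; rewrite lee_fin.
apply: ae_ge0_le_integral => //.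
- by move=> x _; rewrite lee_fin.
- by apply/measurable_EFinP; exact: (measurableT_comp mphi G1.1).
- by move=> x _; rewrite lee_fin sqr_ge0.
- apply/measurable_EFinP; apply: measurable_sqr_enorm_comp.
  by apply: measurable_rVB; [exact: G1.1|exact: G2.1].
pose N : set Rd := ~` (\bigcup_j [set Y j]).
have mN : measurable N.
  apply: measurableC; apply: countable_bigcupT_measurable => [|j].
    exact: countableP.
  exact: measurable_Rd_set1.
exists (snd @^-1` N); split.
- by rewrite -[X in measurable X]setTI; exact: (G2.1 measurableT).
- apply: etrans (esym (G2.2 _ mN)) _; rewrite Ynu.2// (_ : _ @^-1` N = set0) ?measure0//.
  by apply/seteqP; split => // t /= []; exists (q t).
move=> [x y] /= H; apply: contra_not H => -[j _ /= ->] _.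
rewrite lee_fin /phi (bigD1 j)//=.
by rewrite ge_min lexx.
Qed.

End discrete_geodesics.

Section law_invariance.
Context (R : realType) (d : nat) (F : P2 R d -> R).
Hypothesis F_cont : W2_continuous F.

Lemma W2_continuous_law (mu : P2 R d) (tau : R) : 0 < tau ->
  exists2 e : R, 0 < e & forall (dT : measure_display) (T : measurableType dT)
    (P : probability T R) (f g : T -> 'rV[R]_d) (nu : P2 R d),
    has_law P f mu -> has_law P g nu ->
    (msq P (fun t => (f t - g t)%R) <= e%:E)%E -> `|F nu - F mu| < tau.
Proof.
move=> tau0; have [r r0 rF] := F_cont mu tau0.
(* Halving r turns the weak bound on W2 into the strict one that continuity asks for. *)
exists ((r / 2) ^+ 2); first by rewrite exprn_gt0 ?divr_gt0.
move=> dT T P f g nu fmu gnu fg; apply: rF.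
have := sqr_W2_le fmu gnu fg; rewrite ler_sqr ?nnegrE ?sqrtr_ge0//; last first.
  by rewrite divr_ge0// ltW.
by move/le_lt_trans; apply; rewrite ltr_pdivrMr// ltr_pMr// ltr1n.
Qed.

(** [mu] and [nu] can be different terms even though they agree on Borel sets; their W2-distance is
    0, so [F] cannot tell them apart. *)
Lemma W2_continuous_ext (dT : measure_display) (T : measurableType dT)
    (P : probability T R) (f : T -> 'rV[R]_d) (mu nu : P2 R d) :
  has_law P f mu -> has_law P f nu -> F mu = F nu.
Proof.
move=> fmu fnu; apply/eqP; rewrite eq_sym -subr_eq0 -normr_le0.
apply/ler_addgt0Pl => tau tau0; rewrite addr0.
have [e e0 eF] := W2_continuous_law mu tau0.
apply/ltW/(eF _ _ P f f) => //.
rewrite /msq; under eq_integral do rewrite subrr sqr_enorm0.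
by rewrite integral0 lee_fin ltW.
Qed.

End law_invariance.

Section discrete_convexity.
Context (R : realType) (d : nat) (Lambda : R) (F : P2 R d -> R).
Hypothesis F_cont : W2_continuous F.
Hypothesis F_conv : geodesically_convex Lambda F.
Context (dT : measure_display) (T : measurableType dT) (I : finType).
Variables (P : probability T R) (q : T -> I) (X Y : I -> 'rV[R]_d).
Hypothesis mq : finite_cells q.
Variable l : R.
Hypothesis l0 : 0 < l.
Hypothesis noncrossing : forall s s', `|s - s'| <= l -> forall i j,
  enorm (segment_pt X Y s i - segment_pt X Y s' i) ^+ 2 <=
  enorm (segment_pt X Y s i - segment_pt X Y s' j) ^+ 2.

Lemma noncrossing_convexity (mu0 mut mu1 : P2 R d) (t : R) : 0 <= t <= 1 ->
  has_law P (fun w => X (q w)) mu0 -> has_law P (fun w => Y (q w)) mu1 ->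
  has_law P (fun w => segment_pt X Y t (q w)) mut ->
  F mut <= (1 - t) * F mu0 + t * F mu1 - Lambda / 2 * t * (1 - t) *
    fine (msq P (fun w => (X (q w) - Y (q w))%R)).
Proof.
move=> t01 Xmu Ymu XYmu.
(* The laws are chosen separately for each s; that [rho 0], [rho 1] and [rho t] represent the given
   measures is used only through [F]. *)
have [rho rhoP] := choice (fun s => exists_law
  (measurable_finite_cells (segment_pt X Y s) mq)
  (msq_finite_cells P mq (segment_pt X Y s))).
set C := fine _.
have CE : msq P (fun w => (X (q w) - Y (q w))%R) = C%:E.
  exact/msq_fin/(msq_finite_cells P mq (fun i => X i - Y i)).
have C0 : 0 <= C by rewrite fine_ge0// msq_ge0.
have rho_dist s s' : `|s - s'| <= l ->
    W2 (rho s) (rho s') = `|s - s'| * Num.sqrt C.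
  move=> ss'; have := sqr_W2_discrete mq (rhoP s) (rhoP s') (noncrossing ss').
  have -> : (fun w => segment_pt X Y s (q w) - segment_pt X Y s' (q w)) =
      (fun w => (s' - s) *: (X (q w) - Y (q w))).
    by apply/funext => w; apply/rowP => k; rewrite /segment_pt !mxE; ring.
  have -> : msq P (fun w => (s' - s) *: (X (q w) - Y (q w))) =
      ((s' - s) ^+ 2 * C)%:E.
    rewrite EFinM -CE /msq -ge0_integralZl//=.
    - by apply: eq_integral => w _; rewrite sqr_enormZ EFinM.
    - apply/measurable_EFinP/measurable_sqr_enorm_comp.
      exact: (measurable_finite_cells (fun i => X i - Y i)).
    - by move=> w _; rewrite lee_fin sqr_ge0.
    - by rewrite lee_fin sqr_ge0.
  move=> [] /(congr1 Num.sqrt); rewrite sqrtr_sqr ger0_norm ?sqrtr_ge0// => ->.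
  by rewrite sqrtrM ?sqr_ge0// sqrtr_sqr distrC.
have := @local_strong_convexity R (fun s => F (rho s)) (Lambda / 2 * C) l l0 _ t t01.
have rho0 : F (rho 0) = F mu0.
  apply: (W2_continuous_ext F_cont (rhoP 0)).
  rewrite (_ : (fun _ => _) = fun w => X (q w))//.
  by apply/funext => w; rewrite /segment_pt subr0 scale1r scale0r addr0.
have rho1 : F (rho 1) = F mu1.
  apply: (W2_continuous_ext F_cont (rhoP 1)).
  rewrite (_ : (fun _ => _) = fun w => Y (q w))//.
  by apply/funext => w; rewrite /segment_pt subrr scale0r add0r scale1r.
have rhot : F (rho t) = F mut by exact: (W2_continuous_ext F_cont (rhoP t)).
rewrite rho0 rho1 rhot => H; apply: le_trans (H _) _; last by lra.
move=> a b r a01 b01 abl r01.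
(* All times between a and b are within l of each other, so [rho_dist] gives constant speed. *)
have geo : W2_geodesic (rho a) (rho b) (fun r => rho ((1 - r) * a + r * b)).
  split.
  - by rewrite subr0 mul1r mul0r addr0.
  - by rewrite subrr mul1r mul0r add0r.
  move=> u v /andP[u0 u1] /andP[v0 v1].
  have E : (1 - u) * a + u * b - ((1 - v) * a + v * b) = (v - u) * (a - b) by ring.
  rewrite !rho_dist ?E ?normrM ?(distrC v u) ?mulrA//.
  apply: le_trans abl; rewrite ler_piMl//.
  by rewrite ler_norml; apply/andP; split; lra.
have := F_conv geo r01; rewrite rho_dist// exprMn sqr_sqrtr// real_normK ?num_real//.
by move/le_trans; apply; lra.
Qed.

End discrete_convexity.

(** * Convexity along arbitrary plans *)

Section total_convexity.
Context (R : realType) (d : nat) (hd : (2 <= d)%N) (Lambda : R).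
Variable F : P2 R d -> R.
Hypothesis F_cont : W2_continuous F.
Hypothesis F_conv : geodesically_convex Lambda F.
Context (dT : measure_display) (T : measurableType dT).
Local Notation Rd := (Rd R d).
Variable P : probability T R.
Implicit Types f g : T -> 'rV[R]_d.

Lemma msq_le_cst f (e : R) : measurable_fun [set: T] (f : T -> Rd) ->
  (forall w, enorm (f w) ^+ 2 <= e) -> (msq P f <= e%:E)%E.
Proof.
move=> mf fe; have e0 : 0 <= e by apply: le_trans (fe point); exact: sqr_ge0.
apply: (@le_trans _ _ (\int[P]_w e%:E)%E).
  apply: ge0_le_integral => //.
  - by move=> w _; rewrite lee_fin sqr_ge0.
  - by apply/measurable_EFinP; exact: measurable_sqr_enorm_comp.
  - by move=> w _; rewrite lee_fin.
rewrite integral_cst//; have := probability_le1 P measurableT.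
by move=> /(lee_wpmul2l (_ : 0 <= e%:E)%E); rewrite mule1; apply.
Qed.

Lemma msq_le_perturb f g (k A B : R) : 0 < k ->
  measurable_fun [set: T] (f : T -> Rd) ->
  measurable_fun [set: T] (g : T -> Rd) ->
  (msq P f <= A%:E)%E -> (msq P (fun w => (g w - f w)%R) <= B%:E)%E ->
  (msq P g <= ((1 + k) * A + (1 + k^-1) * B)%:E)%E.
Proof.
move=> k0 mf mg; apply: msq_le2 => //.
- exact: measurable_rVB.
- by rewrite addr_ge0// ltW.
- by rewrite addr_ge0// invr_ge0 ltW.
- by move=> w; have := sqr_enormD_le (f w) (g w - f w) k0; rewrite addrC subrK.
Qed.

Lemma msq_continuous f (tau : R) : measurable_fun [set: T] (f : T -> Rd) ->
  (msq P f < +oo)%E -> 0 < tau ->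
  exists2 e : R, 0 < e & forall g, measurable_fun [set: T] (g : T -> Rd) ->
    (msq P (fun w => (f w - g w)%R) <= e%:E)%E ->
    `|fine (msq P g) - fine (msq P f)| <= tau.
Proof.
move=> mf f_fin tau0.
have fE := msq_fin f_fin; set A := fine (msq P f) in fE *.
have A0 : 0 <= A by rewrite fine_ge0// msq_ge0.
pose k := Num.min 4^-1 (tau / (4 * (A + 1))).
have k0 : 0 < k by rewrite lt_min invr_gt0 ltr0n/= divr_gt0// mulr_gt0// ltr_wpDl.
have [k4 kA] : k <= 4^-1 /\ k * (4 * (A + 1)) <= tau.
  by rewrite -ler_pdivlMr ?mulr_gt0 ?ltr_wpDl// /k !ge_min !lexx orbT.
exists (k * tau / 8) => [|g mg fg]; first by rewrite divr_gt0 ?mulr_gt0.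
have kV : (1 + k^-1) * (k * tau / 8) <= tau / 4.
  have kk : k^-1 * k = 1 by rewrite mulVf// gt_eqF.
  have -> : (1 + k^-1) * (k * tau / 8) = (k + k^-1 * k) * tau / 8 by ring.
  by rewrite kk; nra.
have gf : msq P (fun w => (g w - f w)%R) = msq P (fun w => (f w - g w)%R).
  by apply: eq_integral => w _; rewrite sqr_enormC.
have gle : (msq P g <= ((1 + k) * A + (1 + k^-1) * (k * tau / 8))%:E)%E.
  by apply: (msq_le_perturb k0 mf mg); rewrite ?gf// -fE.
have g_fin : (msq P g < +oo)%E by rewrite (le_lt_trans gle)// ltry.
have gE := msq_fin g_fin; set B := fine (msq P g) in gE *.
have := msq_le_perturb k0 mg mf _ fg (A := B); rewrite gE => /(_ (lexx _)).
move: gle; rewrite gE fE !lee_fin => BA AB.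
have B0 : 0 <= B by rewrite fine_ge0// msq_ge0.
by rewrite ler_norml; apply/andP; split; nra.
Qed.

Lemma total_convexity f g (mu0 mut mu1 : P2 R d) (t : R) : 0 <= t <= 1 ->
  has_law P f mu0 -> has_law P g mu1 ->
  has_law P (fun w => (1 - t) *: f w + t *: g w) mut ->
  F mut <= (1 - t) * F mu0 + t * F mu1 - Lambda / 2 * t * (1 - t) *
    fine (msq P (fun w => (f w - g w)%R)).
Proof.
move=> /andP[t0 t1] fmu gmu fgmu.
have mf := fmu.1; have mg := gmu.1; have mfg := fgmu.1.
apply/ler_addgt0Pr => eps eps0.
(* The budget: one tau for each of the three values of [F], and |Lambda| tau for the change of the
   cost. *)
pose tau := eps / (3 + `|Lambda|).
have L3 : 0 < 3 + `|Lambda| by rewrite ltr_wpDr.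
have tau0 : 0 < tau by rewrite divr_gt0.
have [e0 e0_gt0 F0] := W2_continuous_law F_cont mu0 tau0.
have [e1 e1_gt0 F1] := W2_continuous_law F_cont mu1 tau0.
have [et et_gt0 Ft] := W2_continuous_law F_cont mut tau0.
have f_fin : (msq P f < +oo)%E.
  by rewrite -(has_law_second_moment fmu) P2_finite.
have g_fin : (msq P g < +oo)%E.
  by rewrite -(has_law_second_moment gmu) P2_finite.
have mfBg := measurable_rVB mf mg.
have fg_fin : (msq P (fun w => (f w - g w)%R) < +oo)%E.
  apply: le_lt_trans (ltry _).
  by apply: (msqB_le2 mf mg); [rewrite (msq_fin f_fin)|rewrite (msq_fin g_fin)];
    exact: lexx.
have [eC eC_gt0 FC] := msq_continuous mfBg fg_fin tau0.
(* Rounding and perturbing cost eta / 4 each, hence eta together after doubling. The difference of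
   the two vectors then moves by at most 4 eta, whence eC / 4. *)
pose eta := Num.min (Num.min e0 e1) (Num.min et (eC / 4)).
have eta0 : 0 < eta by rewrite !lt_min e0_gt0 e1_gt0 et_gt0/= divr_gt0.
have [le0 le1 let_ leC] : [/\ eta <= e0, eta <= e1, eta <= et & 4 * eta <= eC].
  by rewrite -ler_pdivlMl// [_^-1 * _]mulrC /eta !ge_min !lexx !orbT.
have eta4 : 0 < eta / 4 by rewrite divr_gt0.
have [I0 [q0 [c0 [mq0 qc0]]]] := exists_quantization mu0 eta4.
have [I1 [q1 [c1 [mq1 qc1]]]] := exists_quantization mu1 eta4.
(* Atoms are indexed by pairs of cells: mass leaving one cell may have several targets, and the
   perturbation separates the coinciding starting points. *)
pose q w : (I0 * I1)%type := (q0 (f w), q1 (g w)).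
have mq : finite_cells q.
  case=> i j; rewrite (_ : _ @^-1` _ = (f @^-1` (q0 @^-1` [set i])) `&`
      (g @^-1` (q1 @^-1` [set j]))).
    rewrite -[X in measurable (X `&` _)]setTI -[X in measurable (_ `&` X)]setTI.
    by apply: measurableI; [exact: (mf measurableT _ (mq0 i))|
      exact: (mg measurableT _ (mq1 j))].
  by apply/seteqP; split => w /=; rewrite /q => -[-> ->].
have [X [Y [Xc Yc [l l0 XY]]]] := noncrossing_perturbation hd
  (fun ij : I0 * I1 => c0 ij.1) (fun ij : I0 * I1 => c1 ij.2) eta4.
have mX := measurable_finite_cells X mq.
have mY := measurable_finite_cells Y mq.
have quant_le (u : T -> 'rV[R]_d) nu (J : finType) (r : Rd -> J) c (Z : I0 * I1 -> 'rV[R]_d) :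
    has_law P u nu -> finite_cells r ->
    (msq nu (fun x : Rd => ((x : 'rV[R]_d) - c (r x))%R) <= (eta / 4)%:E)%E ->
    (forall w, enorm (Z (q w) - c (r (u w))) ^+ 2 <= eta / 4) ->
    (msq P (fun w => (u w - Z (q w))%R) <= eta%:E)%E.
  move=> unu mr ur Zc.
  have mu := unu.1.
  have mrc : measurable_fun setT ((fun x : Rd => (x : 'rV[R]_d) - c (r x)) : Rd -> Rd).
    by apply: measurable_rVB => //; exact: measurable_finite_cells.
  have murc : measurable_fun setT ((fun w => u w - c (r (u w))) : T -> Rd).
    exact: (measurableT_comp mrc mu).
  have mZ := measurable_finite_cells Z mq.
  have mrcu : measurable_fun setT ((fun w => c (r (u w))) : T -> Rd).
    exact: (measurableT_comp (measurable_finite_cells c mr) mu).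
  rewrite -(msq_comp mu (fun A mA => esym (unu.2 A mA)) mrc) in ur.
  have := msqB_le2 murc (measurable_rVB mZ mrcu) ur
    (msq_le_cst (measurable_rVB mZ mrcu) Zc).
  rewrite (_ : 2 * _ + _ = eta); last by lra.
  rewrite (_ : (fun w => u w - c (r (u w)) - (Z (q w) - c (r (u w)))) =
    fun w => u w - Z (q w))//.
  by apply/funext => w; rewrite opprB addrA subrK.
have fX := quant_le _ _ _ _ _ _ fmu mq0 qc0 (fun w => Xc (q w)).
have gY := quant_le _ _ _ _ _ _ gmu mq1 qc1 (fun w => Yc (q w)).
have [nu0 Xnu] := exists_law mX (msq_finite_cells P mq X).
have [nu1 Ynu] := exists_law mY (msq_finite_cells P mq Y).
have [nut XYnu] := exists_law (measurable_finite_cells (segment_pt X Y t) mq)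
  (msq_finite_cells P mq (segment_pt X Y t)).
have t01 : 0 <= t <= 1 by rewrite t0.
have := noncrossing_convexity F_cont F_conv mq l0 XY t01 Xnu Ynu XYnu.
have {}F0 := F0 _ _ _ _ _ _ fmu Xnu (le_trans fX _).
have {}F1 := F1 _ _ _ _ _ _ gmu Ynu (le_trans gY _).
have {F0} : `|F nu0 - F mu0| < tau by apply: F0; rewrite lee_fin.
have {F1} : `|F nu1 - F mu1| < tau by apply: F1; rewrite lee_fin.
have mfX := measurable_rVB mf mX.
have mgY := measurable_rVB mg mY.
have : `|F nut - F mut| < tau.
  apply: (Ft _ _ _ _ _ _ fgmu XYnu).
  apply: (@le_trans _ _ ((1 - t) * eta + t * eta)%:E); last first.
    by rewrite lee_fin; lra.
  apply: (msq_le2 _ mfX mgY _ _ _ fX gY) => //; last 2 first.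
  - by rewrite subr_ge0.
  (* Convexity of the squared norm: the nonnegative term v of the identity is dropped. *)
  - move=> w; have := sqr_enorm_barycenter t (f w - X (q w)) (g w - Y (q w)) 0.
    rewrite subr0.
    set u := enorm (0 - _) ^+ 2; set v := _ * enorm (_ - _) ^+ 2.
    have v0 : 0 <= v by rewrite mulr_ge0 ?sqr_ge0// mulr_ge0// subr_ge0.
    rewrite (sqr_enormC 0) subr0 => <-.
    suff -> : enorm ((1 - t) *: f w + t *: g w - segment_pt X Y t (q w)) ^+ 2 = u.
      by rewrite lerDl.
    rewrite /u (sqr_enormC 0) subr0 /segment_pt; congr (enorm _ ^+ 2).
    by apply/rowP => i; rewrite !mxE; ring.
  exact: (measurable_rVB mfg XYnu.1).
have : `|fine (msq P (fun w => (X (q w) - Y (q w))%R)) -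
         fine (msq P (fun w => (f w - g w)%R))| <= tau.
  apply: FC; first exact: measurable_rVB.
  apply: (@le_trans _ _ (2 * eta + 2 * eta)%:E); last by rewrite lee_fin; lra.
  have := msqB_le2 mfX mgY fX gY.
  rewrite (_ : (fun w => f w - X (q w) - (g w - Y (q w))) =
    fun w => f w - g w - (X (q w) - Y (q w)))//.
  by apply/funext => w; apply/rowP => i; rewrite !mxE; ring.
set C' := fine _; set C := fine _.
rewrite !ltr_norml !ler_norml => /andP[C1 C2] /andP[Ft1 Ft2] /andP[F11 F12] /andP[F01 F02].
have epsE : eps = (3 + `|Lambda|) * tau by rewrite /tau mulrC divfK// gt_eqF.
have LC : - (Lambda / 2 * t * (1 - t) * C') <=
    - (Lambda / 2 * t * (1 - t) * C) + `|Lambda| * tau.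
  have : `|Lambda / 2 * t * (1 - t) * (C - C')| <= `|Lambda| * tau.
    rewrite -!mulrA normrM ler_wpM2l// !mulrA normrM.
    have CC : `|C - C'| <= tau by rewrite distrC ler_norml; apply/andP.
    have tt : 0 <= 2^-1 * t * (1 - t) by rewrite !mulr_ge0// subr_ge0.
    by rewrite [X in X * _]ger0_norm//; have := normr_ge0 (C - C'); nra.
  by move=> /(le_trans (ler_norm _)); lra.
rewrite epsE; have : (1 - t) * F nu0 + t * F nu1 <= (1 - t) * F mu0 + t * F mu1 + tau.
  by clear -t0 t1 tau0 F02 F12; nra.
by clear -LC Ft1 tau0; lra.
Qed.

End total_convexity.

(** * Mixtures and geodesics *)

Section mixture_probability.
Context (R : realType) (dT : measure_display) (T : measurableType dT).
Variables (h : R) (Q1 Q2 : probability T R).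
Hypothesis h01 : 0 <= h <= 1.

Let h_ge0 : 0 <= h. Proof. by case/andP: h01. Qed.
Let onem_h_ge0 : 0 <= 1 - h. Proof. by rewrite subr_ge0; case/andP: h01. Qed.

Let Q : set T -> \bar R := measure_add
  (mscale (NngNum onem_h_ge0) Q1) (mscale (NngNum h_ge0) Q2).

HB.instance Definition _ := Measure.on Q.

Let QE A : Q A = ((1 - h)%:E * Q1 A + h%:E * Q2 A)%E.
Proof. by rewrite /Q measure_addE. Qed.

Let Q_setT : Q setT = 1%E.
Proof. by rewrite QE !probability_setT !mule1 -EFinD subrK. Qed.

HB.instance Definition _ := Measure_isProbability.Build _ _ _ Q Q_setT.

(** Mixes plans on an arbitrary measurable space, where [mix] applies to elements of [P2]. *)
Lemma exists_mixture : exists P : probability T R,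
  (forall A, measurable A -> P A = ((1 - h)%:E * Q1 A + h%:E * Q2 A)%E) /\
  (forall f : T -> \bar R, measurable_fun [set: T] f -> (forall x, 0 <= f x)%E ->
    (\int[P]_x f x = (1 - h)%:E * \int[Q1]_x f x + h%:E * \int[Q2]_x f x)%E).
Proof.
exists Q; split => [A _|f mf f0]; first exact: QE.
by rewrite ge0_integral_measure_add// !ge0_integral_mscale.
Qed.

End mixture_probability.

Section mixture_laws.
Context (R : realType) (d : nat) (dT : measure_display) (T : measurableType dT).
Local Notation Rd := (Rd R d).

Lemma has_law_mix (h : R) (Q Q1 Q2 : probability T R) (f : T -> 'rV[R]_d)
    (mu nu : P2 R d) : 0 <= h <= 1 ->
  (forall A, measurable A -> Q A = ((1 - h)%:E * Q1 A + h%:E * Q2 A)%E) ->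
  has_law Q1 f mu -> has_law Q2 f nu -> has_law Q f (mix h mu nu).
Proof.
move=> h01 QE [mf f1] [_ f2]; split => // A mA.
rewrite mixE// f1// f2// QE//.
by rewrite -[X in measurable X]setTI; exact: mf.
Qed.

Lemma has_law_dirac (p : T) (f : T -> 'rV[R]_d) :
  measurable_fun [set: T] (f : T -> Rd) -> has_law (\d_p : probability T R) f (diracP2 (f p)).
Proof. by move=> mf; split. Qed.

End mixture_laws.

Section geodesic_plans.
Context (R : realType) (d : nat).
Local Notation Rd := (Rd R d).

(** Gluing over a single cell gives the product coupling, whose cost is finite by the second
    moments; the infimum is therefore finite and can be approached. *)
Lemma exists_near_optimal_coupling (mu nu : P2 R d) (e : R) : 0 < e ->
  exists2 G, coupling mu nu G & (transport_cost G <= (W2 mu nu ^+ 2 + e)%:E)%E.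
Proof.
move=> e0.
have mtt (S : Type) (i : unit) : (fun _ : S => tt) @^-1` [set i] = setT.
  by apply/seteqP; split => // x _; case: i.
have [P [P1 P2 _]] := @exists_glued_probability R _ _ Rd Rd unit mu nu
  (fun=> tt) (fun=> tt) ltac:(by move=> i; rewrite mtt)
  ltac:(by move=> i; rewrite mtt) ltac:(by move=> i; rewrite !mtt !probability_setT).
have fmu : has_law P (fst : Rd * Rd -> Rd) mu.
  by split => // A mA; rewrite P1.
have gnu : has_law P (snd : Rd * Rd -> Rd) nu.
  by split => // A mA; rewrite P2.
apply: (exists_coupling_near_W2 e0 fmu gnu).
have f_fin : (msq P (fst : Rd * Rd -> Rd) < +oo)%E.
  by rewrite -(has_law_second_moment fmu) P2_finite.
have g_fin : (msq P (snd : Rd * Rd -> Rd) < +oo)%E.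
  by rewrite -(has_law_second_moment gnu) P2_finite.
apply: le_lt_trans (ltry _).
by apply: (msqB_le2 fmu.1 gnu.1); [rewrite (msq_fin f_fin)|rewrite (msq_fin g_fin)];
  exact: lexx.
Qed.

(* No optimal coupling is needed: near-optimal couplings of the two halves of
   the geodesic are glued along their common marginal up to a small error. *)
Lemma geodesic_plan (mu0 mu1 : P2 R d) (rho : R -> P2 R d) (t e : R) :
  W2_geodesic mu0 mu1 rho -> 0 <= t <= 1 -> 0 < e ->
  exists (P : probability ((Rd * Rd) * (Rd * Rd))%type R)
    (f z g : (Rd * Rd) * (Rd * Rd) -> 'rV[R]_d) (C : R),
    [/\ has_law P f mu0, has_law P z (rho t) & has_law P g mu1] /\
    [/\ msq P (fun w => (f w - g w)%R) = C%:E,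
        W2 mu0 mu1 ^+ 2 <= C,
        t * (1 - t) * C <= t * (1 - t) * W2 mu0 mu1 ^+ 2 + e &
        (msq P (fun w => (z w - ((1 - t) *: f w + t *: g w))%R) <= e%:E)%E].
Proof.
move=> [rho0 rho1 rhoW] /andP[t0 t1] e0.
set W := W2 mu0 mu1 in rhoW *.
have e4 : 0 < e / 4 by rewrite divr_gt0.
have [g1 g1c] := exists_near_optimal_coupling mu0 (rho t) e4.
have [g2 g2c] := exists_near_optimal_coupling (rho t) mu1 e4.
have -> : W2 (rho t) mu1 = (1 - t) * W.
  by rewrite -rho1 rhoW ?lexx ?ler01 ?t0// distrC ger0_norm// subr_ge0.
have -> : W2 mu0 (rho t) = t * W.
  by rewrite -rho0 rhoW ?lexx ?ler01 ?t0// sub0r normrN ger0_norm.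
move=> g2W g1W.
have W0 : 0 <= W ^+ 2 by exact: sqr_ge0.
pose D := W ^+ 2 + e.
have D0 : 0 < D by rewrite ltr_wpDl.
(* Replacing z' by z in the second leg adds at most k D <= e / 4 from the factor 1 + k, and (k + 1)
   e / 8 <= e / 4 from the gluing error k e / 8. *)
pose k := Num.min 1 (e / (4 * D)).
have k0 : 0 < k by rewrite lt_min ltr01 divr_gt0// mulr_gt0.
have [k1 kD] : k <= 1 /\ k * (4 * D) <= e.
  by rewrite -ler_pdivlMr ?mulr_gt0// /k !ge_min !lexx orbT.
have ke : 0 < k * e / 8 by rewrite divr_gt0 ?mulr_gt0.
have [P [P1 P2 Pz]] := glue_couplings ke g1c g2c.
have [g1f g1z] := coupling_has_law g1c; have [g2z g2g] := coupling_has_law g2c.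
have := has_law_comp measurable_fst P1 g1f; set f := (_ \o _) => fmu.
have := has_law_comp measurable_fst P1 g1z; set z := (_ \o _) => zmu.
have := has_law_comp measurable_snd P2 g2z; set z' := (_ \o _) => zmu'.
have := has_law_comp measurable_snd P2 g2g; set g := (_ \o _) => gmu.
have mf := fmu.1; have mz := zmu.1; have mz' := zmu'.1; have mg := gmu.1.
have fz : (msq P (fun w => (f w - z w)%R) <= ((t * W) ^+ 2 + e / 4)%:E)%E.
  apply: le_trans g1W.
  rewrite /transport_cost -[leRHS](msq_comp measurable_fst P1)//.
  exact: (measurable_rVB g1f.1 g1z.1).
have z'g : (msq P (fun w => (z' w - g w)%R) <= (((1 - t) * W) ^+ 2 + e / 4)%:E)%E.
  apply: le_trans g2W.
  rewrite /transport_cost -[leRHS](msq_comp measurable_snd P2)//.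
  exact: (measurable_rVB g2z.1 g2g.1).
have mzg := measurable_rVB mz mg.
have zg := msq_le_perturb k0 (measurable_rVB mz' mg) mzg z'g (B := k * e / 8).
have {zg} : (msq P (fun w => (z w - g w)%R) <=
    (((1 - t) * W) ^+ 2 + 3 / 4 * e)%:E)%E.
  apply: le_trans (zg _) _.
    rewrite (_ : (fun w => _) = fun w => z w - z' w)//.
    by apply/funext => w; rewrite opprB addrA subrK.
  rewrite lee_fin.
  have kk : k^-1 * k = 1 by rewrite mulVf// gt_eqF.
  have -> : (1 + k^-1) * (k * e / 8) = (k + k^-1 * k) * e / 8 by ring.
  rewrite kk.
  have tW : ((1 - t) * W) ^+ 2 <= W ^+ 2.
    rewrite exprMn ler_piMl// expr_le1// ?subr_ge0// lerBlDr lerDl//.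
  have : k * (((1 - t) * W) ^+ 2 + e / 4) <= k * D.
    by rewrite ler_wpM2l ?(ltW k0)// /D; clear -tW e0; lra.
  have : k * e <= e by rewrite ler_piMl// ltW.
  by clear -tW kD e0; move: (((1 - t) * W) ^+ 2) tW => V; lra.
move=> zg.
have mfg := measurable_rVB mf mg.
have f_fin : (msq P f < +oo)%E.
  by rewrite -(has_law_second_moment fmu) P2_finite.
have g_fin : (msq P g < +oo)%E.
  by rewrite -(has_law_second_moment gmu) P2_finite.
have fg_fin : (msq P (fun w => (f w - g w)%R) < +oo)%E.
  apply: le_lt_trans (ltry _).
  by apply: (msqB_le2 mf mg); [rewrite (msq_fin f_fin)|rewrite (msq_fin g_fin)];
    exact: lexx.
have fgE := msq_fin fg_fin; set C := fine _ in fgE.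
have WC : W ^+ 2 <= C by apply: (sqr_W2_le fmu gmu); rewrite fgE.
have mZ : measurable_fun setT ((fun w => z w - ((1 - t) *: f w + t *: g w)) :
    (Rd * Rd) * (Rd * Rd) -> Rd).
  exact: (measurable_rVB mz (measurable_rV_comb (1 - t) t mf mg)).
have tt0 : 0 <= t * (1 - t) by rewrite mulr_ge0// subr_ge0.
have t1' : 0 <= 1 - t by rewrite subr_ge0.
(* The legs (t W)^2 and ((1 - t) W)^2, weighted by 1 - t and t, add up to t (1 - t) W^2. Since C >=
   W^2, what remains bounds by e both the excess of t (1 - t) C and the distance from z to the
   interpolation. *)
have bary := @msq_comb_le _ _ _ _ P _ _ _ _ (t * (1 - t)) (1 - t) t mZ mfg
  (measurable_rVB mf mz) mzg tt0 t1' t0.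
have {bary} : (msq P (fun w => (z w - ((1 - t) *: f w + t *: g w))%R) +
    (t * (1 - t) * C)%:E <= (t * (1 - t) * W ^+ 2 + e)%:E)%E.
  rewrite EFinM -fgE; apply: le_trans (bary _) _.
    by move=> w; rewrite sqr_enorm_barycenter.
  apply: (@le_trans _ _ ((1 - t)%:E * ((t * W) ^+ 2 + e / 4)%:E +
     t%:E * (((1 - t) * W) ^+ 2 + 3 / 4 * e)%:E)%E).
    by apply: leeD; apply: lee_wpmul2l; rewrite ?lee_fin.
  rewrite -!EFinM -EFinD lee_fin; have : t * e <= e by rewrite ler_piMl// ltW.
  by rewrite !exprMn; clear -e0 t0 t1; lra.
move=> bary.
have Z_fin : (msq P (fun w => (z w - ((1 - t) *: f w + t *: g w))%R) < +oo)%E.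
  apply: le_lt_trans (ltry _); apply: le_trans bary.
  by rewrite leeDl// lee_fin mulr_ge0// (le_trans W0).
exists P, f, z, g, C; split; first by [].
move: bary; rewrite (msq_fin Z_fin) -EFinD lee_fin.
set Z := fine _; have Z0 : 0 <= Z by rewrite fine_ge0// msq_ge0.
have := ler_wpM2l tt0 WC; clear -Z0 WC fgE => tWC bary; split=> //.
  by clear -Z0 bary; lra.
by rewrite lee_fin; clear -tWC bary; lra.
Qed.

End geodesic_plans.

(** Both signs of Lambda occur: b <= a is the relevant estimate for positive Lambda, a <= b + tau
    for negative Lambda. *)
Lemma convexity_defect_le (R : realType) (Lambda h a b tau : R) :
  0 <= h <= 1 -> b <= a -> a <= b + tau ->
  - (h * Lambda / 2 * a) <= - (h * Lambda / 2 * b) + `|Lambda| * tau.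
Proof.
move=> /andP[h0 h1] ba ab.
have : `|- Lambda * (h / 2 * (a - b))| <= `|Lambda| * tau.
  rewrite normrM normrN ler_wpM2l// ger0_norm; last first.
    by rewrite mulr_ge0 ?divr_ge0// subr_ge0.
  apply: (@le_trans _ _ (1 * (a - b))); last by lra.
  by rewrite ler_wpM2r ?subr_ge0//; lra.
by move=> /(le_trans (ler_norm _)); lra.
Qed.

(** * Convexity of mixtures and of the flat derivative *)

Section main.
Context (R : realType) (d : nat) (hd : (2 <= d)%N) (Lambda : R).
Variable F : P2 R d -> R.
Hypothesis F_cont : W2_continuous F.
Hypothesis F_conv : geodesically_convex Lambda F.
Local Notation Rd := (Rd R d).

Lemma geodesically_convex_mix (mu : P2 R d) (h : R) : 0 <= h <= 1 ->
  geodesically_convex (h * Lambda) (fun nu => F (mix h mu nu)).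
Proof.
move=> h01 mu0 mu1 rho geo t t01.
have /andP[h0 h1] := h01; have /andP[t0 t1] := t01.
set W := W2 mu0 mu1.
apply/ler_addgt0Pr => eps eps0.
pose tau := eps / (2 + `|Lambda|).
have L2 : 0 < 2 + `|Lambda| by rewrite ltr_wpDr.
have tau0 : 0 < tau by rewrite divr_gt0.
(* The plan is taken with error min(e, tau): e controls the value of [F] at the interpolation, tau
   the excess of the cost. *)
have [e e0 Fe] := W2_continuous_law F_cont (mix h mu (rho t)) tau0.
have e'0 : 0 < Num.min e tau by rewrite lt_min e0.
have [P [f [z [g [C [[fmu zmu gmu] [fgC WC tC Zle]]]]]]] := geodesic_plan geo t01 e'0.
(* The middle component z is carried along to compare the mixture with [rho t] to the law of the
   interpolation on one space. *)
have mfzg : measurable_fun setT ((fun w => (f w, (z w, g w))) :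
    (Rd * Rd) * (Rd * Rd) -> Rd * (Rd * Rd)).
  apply/measurable_fun_pairP; split; first exact: fmu.1.
  by apply/measurable_fun_pairP; split; [exact: zmu.1|exact: gmu.1].
have mdiag : measurable_fun setT ((fun x => (x, (x, x))) : Rd -> Rd * (Rd * Rd)).
  apply/measurable_fun_pairP; split; first exact: measurable_id.
  by apply/measurable_fun_pairP; split; exact: measurable_id.
have [Q2 Q2E] := exists_image_probability P mfzg.
have [Q1 Q1E] := exists_image_probability mu mdiag.
have [Q [QE Qint]] := exists_mixture Q1 Q2 h01.
pose pf (p : Rd * (Rd * Rd)) : 'rV[R]_d := p.1.
pose pz (p : Rd * (Rd * Rd)) : 'rV[R]_d := p.2.1.
pose pg (p : Rd * (Rd * Rd)) : 'rV[R]_d := p.2.2.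
have mpf : measurable_fun setT (pf : _ -> Rd) by exact: measurable_fst.
have mpz : measurable_fun setT (pz : _ -> Rd).
  by apply: (@measurableT_comp _ _ _ _ _ _ fst _ snd).
have mpg : measurable_fun setT (pg : _ -> Rd).
  by apply: (@measurableT_comp _ _ _ _ _ _ snd _ snd).
have law (u : Rd * (Rd * Rd) -> 'rV[R]_d) (v : _ -> 'rV[R]_d) (nu : P2 R d) :
    measurable_fun setT (u : _ -> Rd) -> (forall x, u (x, (x, x)) = x) ->
    (forall w, u (f w, (z w, g w)) = v w) ->
    has_law P v nu -> has_law Q u (mix h mu nu).
  move=> mu_ ux uv [mv vnu]; apply: (has_law_mix h01 QE); split => // A mA.
    rewrite Q1E; congr (P2_prob mu _); apply/seteqP; split => x /=; rewrite ux//.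
  by rewrite vnu// Q2E; congr (P _); apply/seteqP; split => w /=; rewrite uv.
have fQ := law pf f mu0 mpf (fun=> erefl) (fun=> erefl) fmu.
have zQ := law pz z (rho t) mpz (fun=> erefl) (fun=> erefl) zmu.
have gQ := law pg g mu1 mpg (fun=> erefl) (fun=> erefl) gmu.
(* Here u vanishes on the diagonal, so the part coming from mu contributes nothing and the factor h
   remains. *)
have msqQ (u : Rd * (Rd * Rd) -> 'rV[R]_d) (v : _ -> 'rV[R]_d) :
    measurable_fun setT (u : _ -> Rd) -> (forall x, u (x, (x, x)) = 0) ->
    (forall w, u (f w, (z w, g w)) = v w) -> msq Q u = (h%:E * msq P v)%E.
  move=> mu_ ux uv; rewrite /msq Qint; last 2 first.
  - exact/measurable_EFinP/measurable_sqr_enorm_comp.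
  - by move=> p; rewrite lee_fin sqr_ge0.
  rewrite (ge0_integral_image mdiag (fun A _ => Q1E A)); last 2 first.
  - exact/measurable_EFinP/measurable_sqr_enorm_comp.
  - by move=> p; rewrite lee_fin sqr_ge0.
  rewrite (ge0_integral_image mfzg (fun A _ => Q2E A)); last 2 first.
  - exact/measurable_EFinP/measurable_sqr_enorm_comp.
  - by move=> p; rewrite lee_fin sqr_ge0.
  under eq_integral do rewrite ux sqr_enorm0.
  rewrite integral0 mule0 add0e; congr (_ * _)%E.
  by apply: eq_integral => w _; rewrite uv.
have mpt := measurable_rV_comb (1 - t) t mpf mpg.
have pfgE : msq Q (fun p => (pf p - pg p)%R) = (h * C)%:E.
  rewrite (msqQ _ (fun w => f w - g w)) ?fgC//; first exact: measurable_rVB.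
  by move=> x; rewrite /pf /pg subrr.
have Zle' : (msq Q (fun p => (pz p - ((1 - t) *: pf p + t *: pg p))%R) <= e%:E)%E.
  rewrite (msqQ _ (fun w => z w - ((1 - t) *: f w + t *: g w)))//.
  - apply: le_trans (lee_wpmul2l _ Zle) _; first by rewrite lee_fin.
    rewrite -EFinM lee_fin; apply: (@le_trans _ _ (Num.min e tau)).
      by rewrite ler_piMl// ltW.
    by rewrite ge_min lexx.
  - exact: measurable_rVB.
  - by move=> x; rewrite /pz /pf /pg -scalerDl subrK scale1r subrr.
have f_fin : (msq Q pf < +oo)%E.
  by rewrite -(has_law_second_moment fQ) P2_finite.
have g_fin : (msq Q pg < +oo)%E.
  by rewrite -(has_law_second_moment gQ) P2_finite.
have pt_fin : (msq Q (fun p => ((1 - t) *: pf p + t *: pg p)%R) < +oo)%E.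
  apply: le_lt_trans (ltry _).
  apply: (msq_le2 mpt mpf mpg (l := 2 * (1 - t) ^+ 2) (m := 2 * t ^+ 2)).
  - by rewrite mulr_ge0// sqr_ge0.
  - by rewrite mulr_ge0// sqr_ge0.
  - move=> w; apply: le_trans (sqr_enormD_le2 _ _) _.
    by rewrite !sqr_enormZ !mulrA.
  - by rewrite (msq_fin f_fin); exact: lexx.
  - by rewrite (msq_fin g_fin); exact: lexx.
have [nu ptnu] := exists_law mpt pt_fin.
have := Fe _ _ _ _ _ _ zQ ptnu Zle'.
have := total_convexity hd F_cont F_conv t01 fQ gQ ptnu.
rewrite pfgE /= ltr_norml => H /andP[H1 H2].
have epsE : eps = (2 + `|Lambda|) * tau by rewrite /tau mulrC divfK// gt_eqF.
have tC' : t * (1 - t) * C <= t * (1 - t) * W ^+ 2 + tau.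
  by apply: le_trans tC _; rewrite lerD2l ge_min lexx orbT.
have tC2 : t * (1 - t) * W ^+ 2 <= t * (1 - t) * C.
  by rewrite ler_wpM2l// mulr_ge0// subr_ge0.
have := convexity_defect_le Lambda h01 tC2 tC'.
have eW : h * Lambda / 2 * t * (1 - t) * W ^+ 2 =
  h * Lambda / 2 * (t * (1 - t) * W ^+ 2) by rewrite !mulrA.
have eC : Lambda / 2 * t * (1 - t) * (h * C) =
  h * Lambda / 2 * (t * (1 - t) * C) by ring.
rewrite epsE eW -/W; move: H H1; rewrite eC.
set r := (1 - t) * _ + _.
move: tau0.
move: (F nu) (F (mix h mu (rho t))) r (h * Lambda / 2 * (t * (1 - t) * W ^+ 2))
  (h * Lambda / 2 * (t * (1 - t) * C)) `|Lambda| (tau).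
by clear => a b r' x y L u; lra.
Qed.

Lemma dirac_mix_convex (mu : P2 R d) (y0 y1 : 'rV[R]_d) (t h : R) :
  0 <= t <= 1 -> 0 <= h <= 1 ->
  F (mix h mu (diracP2 ((1 - t) *: y0 + t *: y1))) <=
    (1 - t) * F (mix h mu (diracP2 y0)) + t * F (mix h mu (diracP2 y1))
    - h * Lambda * (t * (1 - t) / 2) * enorm (y0 - y1) ^+ 2.
Proof.
move=> t01 h01.
have mdiag : measurable_fun setT ((fun x => (x, x)) : Rd -> Rd * Rd).
  by apply/measurable_fun_pairP; split; exact: measurable_id.
have [Q1 Q1E] := exists_image_probability mu mdiag.
pose Q2 : probability (Rd * Rd)%type R := \d_((y0, y1) : Rd * Rd).
have [Q [QE Qint]] := exists_mixture Q1 Q2 h01.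
pose pf (p : Rd * Rd) : 'rV[R]_d := p.1.
pose pg (p : Rd * Rd) : 'rV[R]_d := p.2.
have mpf : measurable_fun setT (pf : _ -> Rd) by exact: measurable_fst.
have mpg : measurable_fun setT (pg : _ -> Rd) by exact: measurable_snd.
have law (u : Rd * Rd -> 'rV[R]_d) : measurable_fun setT (u : _ -> Rd) ->
    (forall x, u (x, x) = x) -> has_law Q u (mix h mu (diracP2 (u (y0, y1)))).
  move=> mu_ ux; apply: (has_law_mix h01 QE); last exact: has_law_dirac.
  split => // A mA; rewrite Q1E; congr (P2_prob mu _).
  by apply/seteqP; split => x /=; rewrite ux.
have mpt := measurable_rV_comb (1 - t) t mpf mpg.
have ptx (x : Rd) : (1 - t) *: pf (x, x) + t *: pg (x, x) = x.
  by rewrite -scalerDl subrK scale1r.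
have := total_convexity hd F_cont F_conv t01 (law pf mpf (fun=> erefl))
  (law pg mpg (fun=> erefl)) (law _ mpt ptx).
rewrite /pf /pg /=.
have mB : measurable_fun setT (fun p : Rd * Rd => (enorm (p.1 - p.2 : 'rV[R]_d) ^+ 2)%:E).
  apply/measurable_EFinP/measurable_sqr_enorm_comp.
  exact: (measurable_rVB mpf mpg).
have -> : msq Q (fun p => (p.1 - p.2 : 'rV[R]_d)%R) = (h * enorm (y0 - y1) ^+ 2)%:E.
  rewrite /msq Qint//; last by move=> p; rewrite lee_fin sqr_ge0.
  rewrite (ge0_integral_image mdiag (fun A _ => Q1E A))//; last first.
    by move=> p; rewrite lee_fin sqr_ge0.
  under eq_integral do rewrite subrr sqr_enorm0.
  rewrite integral0 mule0 add0e integral_dirac//.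
  by rewrite diracT mul1e.
by move/le_trans; apply; rewrite /=; lra.
Qed.

(** By the normalization of D, the difference quotient towards the Dirac mass at y tends to D y
    itself. The terms F mu cancel because the weights sum to 1, and the defect, linear in h,
    survives the division. *)
Lemma flat_derivative_convex (mu : P2 R d) (D : 'rV[R]_d -> R) :
  is_flat_derivative F mu D -> lambda_convex Lambda D.
Proof.
move=> [mD _ Dlim D0] y0 y1 t t01.
have Dlim' y : (F (mix h mu (diracP2 y)) - F mu) / h @[h --> 0^'+] --> D y.
  have := Dlim (diracP2 y); rewrite D0 subr0.
  rewrite /Rintegral integral_dirac//; last exact/measurable_EFinP.
  by rewrite diracT mul1e.
set E := enorm (y0 - y1) ^+ 2.
have cvgR : (1 - t) * ((F (mix h mu (diracP2 y0)) - F mu) / h) +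
    t * ((F (mix h mu (diracP2 y1)) - F mu) / h) - Lambda / 2 * t * (1 - t) * E
    @[h --> 0^'+] --> (1 - t) * D y0 + t * D y1 - Lambda / 2 * t * (1 - t) * E.
  apply: cvgB; last exact: cvg_cst.
  by apply: cvgD; apply: cvgMr; exact: Dlim'.
apply: ler_cvg_to (Dlim' _) cvgR _.
near=> h.
have h0 : 0 < h by near: h; exact: nbhs_right_gt.
have h1 : h <= 1 by near: h; exact: nbhs_right_le.
have h01 : 0 <= h <= 1 by rewrite ltW.
have := dirac_mix_convex mu y0 y1 t01 h01; rewrite -/E => H.
rewrite ler_pdivrMr//.
have hV : h^-1 * h = 1 by rewrite mulVf// gt_eqF.
set a := F _ in H *; set b := F (mix h mu (diracP2 y0)) in H *.
set c := F (mix h mu (diracP2 y1)) in H *.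
have -> : ((1 - t) * ((b - F mu) / h) + t * ((c - F mu) / h) -
    Lambda / 2 * t * (1 - t) * E) * h =
  (1 - t) * (b - F mu) * (h^-1 * h) + t * (c - F mu) * (h^-1 * h) -
    Lambda / 2 * t * (1 - t) * E * h by ring.
by rewrite hV; lra.
Unshelve. all: by end_near. Qed.

End main.

Theorem lemma4p9 (R : realType) (d : nat) (hd : (2 <= d)%N) (Lambda : R)
    (F : P2 R d -> R) (F_cont : W2_continuous F)
    (F_conv : geodesically_convex Lambda F) (mu : P2 R d) :
  (forall h : R, 0 <= h <= 1 ->
     geodesically_convex (h * Lambda) (fun nu => F (mix h mu nu)))
  /\
  (flat_differentiable F mu ->
     (forall (y0 y1 : 'rV[R]_d) (t h : R), 0 <= t <= 1 -> 0 <= h <= 1 ->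
        F (mix h mu (diracP2 ((1 - t) *: y0 + t *: y1))) <=
          (1 - t) * F (mix h mu (diracP2 y0))
          + t * F (mix h mu (diracP2 y1))
          - h * Lambda * (t * (1 - t) / 2) * enorm (y0 - y1) ^+ 2)
     /\
     (forall D : 'rV[R]_d -> R, is_flat_derivative F mu D ->
        lambda_convex Lambda D)).
Proof.
split=> [h|_]; first exact: geodesically_convex_mix.
by split=> [*|D]; [exact: dirac_mix_convex|exact: flat_derivative_convex].
Qed.
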